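(* Let $\Gamma\subset SL(2,\mathbb Z)$ be a normal subgroup of finite index, and let $(\lambda,\delta)\in\mathbb C\times\mathbb Z/2\mathbb Z$ satisfy either $\lambda\in i\mathbb R$ (with $\delta=0$ or $\delta=1$), or $\delta=0$ and $\lambda\in(-1,0)\cup(0,1)$. Let $\tau\in(V_{\lambda,\delta}^{-\infty})^\Gamma$ be a $\Gamma$-automorphic distribution satisfying the natural extension condition (see context), and let $\phi_\tau$ be its normalized continuous antiderivative. If $x_0\in\mathbb R$ is irrational and $\operatorname{Re}\tau\not\equiv 0$, then $$\limsup_{x\to x_0}\ |x-x_0|^{-\alpha}\,\bigl|\operatorname{Re}\phi_\tau(x)-\operatorname{Re}\phi_\tau(x_0)\bigr|\ =\ \infty$$ in each of the following cases: a) $\operatorname{Re}\lambda\le 0$ and $\alpha\ge 1+\operatorname{Re}\lambda$; b) $\operatorname{Re}\lambda\le 0$, $\alpha>\frac{1+\operatorname{Re}\lambda}{2}$, and $x_0$ has irrationality measure $2$; c) $\lambda>0$ and $\alpha>\frac{1+\operatorname{Re}\lambda}{2}$.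
   Context: Notation: $G=SL(2,\mathbb R)$, $e(x)=e^{2\pi i x}$. $C^{-\infty}(\mathbb R)$ is the space of complex-valued distributions on $\mathbb R$, dual to compactly supported smooth measures, so that distributions transform like functions. The space $V_{\lambda,\delta}^{-\infty}$: pairs $(\tau,\tilde\tau)\in C^{-\infty}(\mathbb R)\times C^{-\infty}(\mathbb R)$ such that $\tilde\tau(x)=(\operatorname{sgn}x)^\delta|x|^{\lambda-1}\tau(-1/x)$ for $x\ne0$. A pair is denoted by its first member $\tau$. The group $G$ acts on it by $\pi_{\lambda,\delta}$: for $g^{-1}=\begin{pmatrix}a&b\\c&d\end{pmatrix}$, the first member of $\pi_{\lambda,\delta}(g)(\tau,\tilde\tau)$ is $$(\pi_{\lambda,\delta}(g)\tau)(x)=(\operatorname{sgn}(cx+d))^\delta|cx+d|^{\lambda-1}\tau\Bigl(\frac{ax+b}{cx+d}\Bigr)\quad\text{where }cx+d\neq0,$$ and equals $(\operatorname{sgn}(-(ax+b)))^\delta|ax+b|^{\lambda-1}\tilde\tau\bigl(-\frac{cx+d}{ax+b}\bigr)$ where $ax+b\ne0$ (the two expressions agree on the overlap). The second member of $\pi_{\lambda,\delta}(g)(\tau,\tilde\tau)$ is the first member of $\pi_{\lambda,\delta}(wg)(\tau,\tilde\tau)$, where $w^{-1}=\begin{pmatrix}0&-1\\1&0\end{pmatrix}$. $(V_{\lambda,\delta}^{-\infty})^\Gamma$ denotes the space of $\Gamma$-invariants, called $\Gamma$-automorphic distributions. Let $N\ge1$ be the integer such that $\begin{pmatrix}1&n\\0&1\end{pmatrix}\in\Gamma\iff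 N\mid n$. Each $\tau\in(V_{\lambda,\delta}^{-\infty})^\Gamma$ is periodic of period $N$, with Fourier series $\tau(x)=c_{\tau,0}+\sum_{n\ne0}c_n e(nx/N)$. Since $\Gamma$ is normal, the same applies to all translates $\pi_{\lambda,\delta}(\gamma)\tau$, $\gamma\in SL(2,\mathbb Z)$. Natural extension condition: for $\tau$ and for each translate $\pi_{\lambda,\delta}(\gamma)\tau$, $\gamma\in SL(2,\mathbb Z)$ (in place of $\tau$): (i) the constant Fourier coefficient is $0$ unless $\operatorname{Re}\lambda>0$; and (ii) the distribution $\tilde\tau$ on all of $\mathbb R$ equals the sum of the locally integrable function $c_{\tau,0}(\operatorname{sgn}x)^\delta|x|^{\lambda-1}$ (which is absent if $c_{\tau,0}=0$) and the canonical extension across $x=0$ of $(\operatorname{sgn}x)^\delta|x|^{\lambda-1}\sum_{n\neq0}c_ne(-n/(Nx))$. Here the canonical extension is the unique extension $f$ which vanishes to infinite order at $0$, i.e. such that for each $m\ge0$, on some neighborhood of $0$, $f=x^m\sum_{j=0}^{J}x^j\frac{d^j}{dx^j}h_j$ with finitely many bounded measurable functions $h_j$; it is obtained by repeated integration by parts. Moreover $\tau$ is not a nonzero constant with $(\lambda,\delta)=(1,0)$. Antiderivative: under these hypotheses on $\tau$ and $(\lambda,\delta)$ it is known (an earlier result of Schmid) that $\tau$ has a continuous antiderivative; $\phi_\tau$ denotes the unique continuous function, periodic of period $N$, with $\tau=c_{\tau,0}+\phi_\tau'$ and $\int_0^N\phi_\tau(x)\,dx=0$. An irrational number $x_0$ has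 irrationality measure $2$ if for no $A>1$ are there infinitely many rationals $p/q$ (with $p,q$ coprime integers and $q>0$) such that $|p-qx_0|<q^{-A}$. *)

(* Defs.v *)
From HB Require Import structures.
From mathcomp Require Import all_boot all_order all_algebra.
From mathcomp Require Import all_classical all_reals all_analysis.
From mathcomp Require Import complex.

Set Implicit Arguments.
Unset Strict Implicit.
Unset Printing Implicit Defensive.

Import Order.TTheory GRing.Theory Num.Theory.
Import numFieldNormedType.Exports.
Local Open Scope classical_set_scope.
Local Open Scope ring_scope.
Local Open Scope complex_scope.

(* Analysis of C-valued functions is done componentwise, under the
   identification of R[i] with R^2. *)
Section ComplexValued.
Variable R : realType.

Definition re (z : R[i]) : R := complex.Re z.
Definition im (z : R[i]) : R := complex.Im z.
Definition cabs (z : R[i]) : R := re `|z|.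

Definition ccvg (u : nat -> R[i]) (l : R[i]) : Prop :=
  ((fun n => re (u n)) @ \oo --> re l) /\ ((fun n => im (u n)) @ \oo --> im l).

Definition ccontinuous (f : R -> R[i]) : Prop :=
  continuous (fun x => re (f x)) /\ continuous (fun x => im (f x)).

Definition cmeasurable (f : R -> R[i]) : Prop :=
  measurable_fun setT (fun x => re (f x)) /\
  measurable_fun setT (fun x => im (f x)).

Definition csmooth (f : R -> R[i]) : Prop := forall (n : nat) (x : R),
  derivable (derive1n n (fun t => re (f t))) x 1 /\
  derivable (derive1n n (fun t => im (f t))) x 1.

Definition cderiven (n : nat) (f : R -> R[i]) : R -> R[i] := fun x =>
  (derive1n n (fun t => re (f t))) x +i* (derive1n n (fun t => im (f t))) x.

Definition cintegral (D : set R) (f : R -> R[i]) : R[i] :=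
  (\int[@lebesgue_measure R]_(x in D) re (f x)) +i*
  (\int[@lebesgue_measure R]_(x in D) im (f x)).

Definition cis (t : R) : R[i] := cos t +i* sin t.

(* exp(2 pi i x) *)
Definition expi2pi (x : R) : R[i] := cis (2 * pi * x).

(* r ^ s for r > 0 and complex s *)
Definition cpow (r : R) (s : R[i]) : R[i] := (r `^ re s)%:C * cis (im s * ln r).

(* (sgn x)^delta |x|^s, used only for x <> 0 or up to null sets *)
Definition sgpow (delta : 'Z_2) (s : R[i]) (x : R) : R[i] :=
  (Num.sg x ^+ delta)%:C * cpow `|x| s.

End ComplexValued.

Section Distributions.
Variable R : realType.

(* Only the values on test functions matter: functionals are always compared
   by [deq_on].  A function f is viewed as the functional
   phi |-> \int f(x) phi(x) dx, so functionals transform like functions. *)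
Definition functional : Type := (R -> R[i]) -> R[i].

Definition test_on (U : set R) (phi : R -> R[i]) : Prop :=
  csmooth phi /\
  exists K : set R, [/\ compact K, K `<=` U & forall x, ~ K x -> phi x = 0].

Definition test : (R -> R[i]) -> Prop := test_on setT.

Record is_distribution (T : functional) : Prop := {
  distribution_linear : forall (a : R[i]) (phi psi : R -> R[i]),
    test phi -> test psi ->
    T (fun x => a * phi x + psi x) = a * T phi + T psi;
  distribution_continuous : forall M : R,
    exists (C : R) (k : nat), forall (phi : R -> R[i]) (B : R),
      test phi -> (forall x, M < `|x| -> phi x = 0) ->
      (forall (j : nat) (x : R), (j <= k)%N -> cabs (cderiven j phi x) <= B) ->
      cabs (T phi) <= C * B }.

Definition deq_on (U : set R) (S T : functional) : Prop :=
  forall phi, test_on U phi -> S phi = T phi.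

Definition dist_fun (f : R -> R[i]) : functional :=
  fun phi => cintegral setT (fun x => f x * phi x).

Definition dist_add (S T : functional) : functional := fun phi => S phi + T phi.

Definition dmul (f : R -> R[i]) (T : functional) : functional :=
  fun phi => T (fun x => f x * phi x).

Definition dderive (T : functional) : functional :=
  fun phi => - T (cderiven 1 phi).

Definition dsum (n : nat) (T : nat -> functional) : functional :=
  fun phi => \sum_(j < n) T j phi.

(* The pullback T(h(x)) of T under a diffeomorphism h : U -> V with inverse
   k : V -> U; it is to be evaluated on test functions supported in U. *)
Definition dpull (k : R -> R) (V : set R) (T : functional) : functional :=
  fun phi => T (fun y => if y \in V then `|derive1 k y|%:C * phi (k y) else 0).

(* The real part of T, as a (complex-linear) functional. *)
Definition dre (T : functional) : functional :=
  fun phi => (T phi + (T (fun x => (phi x)^*))^*) / 2%:R.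

(* T is the sum of the functions u n, n in Z, in the distribution sense on U. *)
Definition dseries_on (U : set R) (u : int -> R -> R[i]) (T : functional)
    : Prop :=
  forall phi, test_on U phi ->
    ccvg (fun K : nat => dist_fun (u 0) phi +
            \sum_(1 <= n < K.+1)
               (dist_fun (u n%:Z) phi + dist_fun (u (- n%:Z)) phi))
         (T phi).

Definition vanishes_infinite_order_at0 (T : functional) : Prop :=
  forall m : nat, exists (eps : R) (J : nat) (h : nat -> R -> R[i]),
  [/\ 0 < eps,
      forall j, cmeasurable (h j) /\ exists B : R, forall x, cabs (h j x) <= B
    & deq_on (ball 0 eps) T
        (dmul (fun x => (x ^+ m)%:C)
          (dsum J.+1 (fun j =>
             dmul (fun x => (x ^+ j)%:C) (iter j dderive (dist_fun (h j))))))].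

End Distributions.

Section Groups.

Definition mx2 (A : Type) (a b c d : A) : 'M[A]_2 :=
  \matrix_(i < 2, j < 2)
    if i == 0 then (if j == 0 then a else b) else (if j == 0 then c else d).

Definition SL2Z : set 'M[int]_2 := [set g | \det g = 1].

Definition normal_finite_index (Gamma : set 'M[int]_2) : Prop :=
  [/\ Gamma `<=` SL2Z,
      Gamma 1%:M,
      (forall g h, Gamma g -> Gamma h -> Gamma (g *m h)) /\
      (forall g, Gamma g -> Gamma (invmx g)),
      forall g h, SL2Z g -> Gamma h -> Gamma (g *m h *m invmx g)
    & finite_set [set [set g *m h | h in Gamma] | g in SL2Z]].

(* The width N of the cusp at infinity. *)
Definition cusp_width (Gamma : set 'M[int]_2) (N : nat) : Prop :=
  (0 < N)%N /\
  forall n : int, Gamma (mx2 1 n 0 1) <-> (N%:Z %| n)%Z.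

End Groups.

Section PrincipalSeries.
Variable R : realType.
Variables (lambda : R[i]) (delta : 'Z_2).

Definition real_mx (g : 'M[int]_2) : 'M[R]_2 := map_mx intr g.

Definition mobius_num (M : 'M[R]_2) (x : R) : R := M 0 0 * x + M 0 1.
Definition mobius_den (M : 'M[R]_2) (x : R) : R := M 1 0 * x + M 1 1.
Definition mobius (M : 'M[R]_2) (x : R) : R := mobius_num M x / mobius_den M x.

(* For M = (a b; c d) in SL(2,R), the distribution
   (sgn (cx+d))^delta |cx+d|^(lambda-1) T((ax+b)/(cx+d)) on cx+d <> 0. *)
Definition slash (M : 'M[R]_2) (T : functional R) : functional R :=
  dmul (fun x => sgpow delta (lambda - 1) (mobius_den M x))
    (dpull (mobius (invmx M)) [set y | mobius_den (invmx M) y != 0] T).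

Definition winv : 'M[R]_2 := mx2 0 (-1) 1 0.
Definition weyl : 'M[R]_2 := invmx winv.

Definition Vspace (p : functional R * functional R) : Prop :=
  [/\ is_distribution p.1, is_distribution p.2
    & deq_on [set x | x != 0] p.2 (slash winv p.1)].

(* sigma is the first member of pi(g) p.  Since cx+d and ax+b have no common
   zero, the two conditions determine the distribution sigma on R. *)
Definition pi_first (g : 'M[R]_2) (p : functional R * functional R)
    (sigma : functional R) : Prop :=
  let h := invmx g in
  deq_on [set x | mobius_den h x != 0] sigma (slash h p.1) /\
  deq_on [set x | mobius_num h x != 0] sigma
    (slash (mx2 (h 1 0) (h 1 1) (- h 0 0) (- h 0 1)) p.2).

(* q = pi(g) p *)
Definition pi_act (g : 'M[R]_2) (p q : functional R * functional R) : Prop :=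
  pi_first g p q.1 /\ pi_first (weyl *m g) p q.2.

Definition automorphic (Gamma : set 'M[int]_2)
    (p : functional R * functional R) : Prop :=
  Vspace p /\ forall g, Gamma g -> pi_act (real_mx g) p p.

Definition fourier_series (N : nat) (T : functional R) (c : int -> R[i])
    : Prop :=
  dseries_on setT (fun n x => c n * expi2pi (n%:~R * x / N%:R)) T.

Definition natural_extension1 (N : nat) (p : functional R * functional R)
    : Prop :=
  exists c : int -> R[i],
  [/\ fourier_series N p.1 c,
      ~ (0 < re lambda) -> c 0 = 0
    & exists f : functional R,
      [/\ is_distribution f,
          dseries_on [set x | x != 0]
            (fun n x => if n == 0 then 0 else
               sgpow delta (lambda - 1) x *
               (c n * expi2pi (- n%:~R / (N%:R * x)))) f,
          vanishes_infinite_order_at0 f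
        & deq_on setT p.2
            (dist_add (dist_fun (fun x => c 0 * sgpow delta (lambda - 1) x)) f)]].

Definition natural_extension (N : nat) (p : functional R * functional R)
    : Prop :=
  [/\ natural_extension1 N p,
      forall (g : 'M[int]_2) (q : functional R * functional R),
        SL2Z g -> Vspace q -> pi_act (real_mx g) p q -> natural_extension1 N q
    & ~ [/\ lambda = 1, delta = 0
          & exists2 a : R[i], a != 0 & deq_on setT p.1 (dist_fun (fun=> a))]].

End PrincipalSeries.

Section Antiderivative.
Variable R : realType.

(* phi is the normalized antiderivative of the N-periodic distribution T whose
   constant Fourier coefficient is c0. *)
Definition normalized_antiderivative (N : nat) (T : functional R) (c0 : R[i])
    (phi : R -> R[i]) : Prop :=
  [/\ ccontinuous phi,
      forall x, phi (x + N%:R) = phi x,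
      deq_on setT T (dist_add (dist_fun (fun=> c0)) (dderive (dist_fun phi)))
    & cintegral `[0, N%:R] phi = 0].

(* [numq] and [denq] give the coprime numerator and positive denominator. *)
Definition irrationality_measure2 (x : R) : Prop :=
  forall A : R, 1 < A ->
    finite_set [set r : rat |
      `|(numq r)%:~R - (denq r)%:~R * x| < (denq r)%:~R `^ (- A)].

End Antiderivative.

(* Main.v *)
(* Let u = -(c z + d) be the negated denominator of a matrix H of Gamma.
   Automorphy turns the pairing of tau with |u|^(-1-lambda) F, F a real test
   function, into the pairing with F o H^-1, and the latter is again real; hence
   real parts survive.  If q is a denominator occurring in the continued
   fraction of x0, H can be chosen so that u is of size q on a prescribed
   interval, which H maps into a ball of radius O(q^-2) around x0.  A Hoelder
   bound of exponent alpha for Re phi at x0 therefore gives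
   Re <tau, |u|^(-1-lambda) F> = O(q^-2 + q^(-2 alpha)).
   If lambda is real, taking F = u^(1+lambda) chi yields
   Re <tau, chi> = O(q^(1+lambda) (q^-2 + q^(-2 alpha))) -> 0.
   If nu = Im lambda <> 0, one uses two matrices differing by a further
   parabolic step: the phases |u|^(-i nu), |u'|^(-i nu) are then uniformly
   independent over the reals, and every real chi is a combination of the two
   with real coefficients.  In all cases Re tau = 0 as soon as
   alpha > (1 + Re lambda)/2. *)
Require Import Defs.
From mathcomp Require Import all_boot all_order all_algebra.
From mathcomp Require Import all_classical all_reals all_analysis.
From mathcomp Require Import complex ring lra zify.

Set Implicit Arguments.
Unset Strict Implicit.
Unset Printing Implicit Defensive.

Import Order.TTheory GRing.Theory Num.Theory.
Import numFieldNormedType.Exports.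
Local Open Scope classical_set_scope.
Local Open Scope ring_scope.
Local Open Scope complex_scope.

(** * Smooth real functions on open subsets of the line *)

Section SmoothOn.
Context {R : realType}.
Implicit Types (U V : set R) (f g h : R -> R).

(** The recursion takes the innermost derivative off first, so that closure under products and
    compositions follows by induction on [n] with the functions generalized. The last derivative
    need not be continuous; quantified over all [n], this makes no difference. *)
Fixpoint Ck_on (n : nat) U f : Prop :=
  if n is n'.+1 then
    (forall x, U x -> derivable f x 1) /\ Ck_on n' U (derive1 f)
  else True.

Record smooth_on U f : Prop := SmoothOn {
  smooth_on_derivable1n : forall n x, U x -> derivable (derive1n n f) x 1 }.

Lemma smooth_onP U f : smooth_on U f <-> forall n, Ck_on n U f.
Proof.
split=> [[sf] n|sf].
  elim: n f sf => //= n IH f sf; split; first exact: (sf 0%N).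
  by apply: IH => m x Ux; rewrite -derive1Sn; exact: sf.
constructor=> n; elim: n f sf => [|n IH] f sf x Ux; first exact: (sf 1%N).1.
by rewrite derive1Sn; apply: IH => // m; exact: (sf m.+1).2.
Qed.

Lemma smooth_on_Ck n U f : smooth_on U f -> Ck_on n U f.
Proof. by move=> /smooth_onP. Qed.

Lemma Ck_onS n U f : Ck_on n.+1 U f -> Ck_on n U f.
Proof. by elim: n f => //= n IH f [df sf]; split=> //; apply: IH. Qed.

Lemma open_near_eq U f g x : open U -> {in U, f =1 g} -> U x ->
  {near x, f =1 g}.
Proof.
move=> oU fg Ux; near=> y; apply: fg; apply/mem_set; near: y.
exact: open_nbhs_nbhs.
Unshelve. all: by end_near. Qed.

Lemma derive1_eq_on U f g : open U -> {in U, f =1 g} ->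
  {in U, derive1 f =1 derive1 g}.
Proof.
move=> oU fg x /set_mem Ux; rewrite !derive1E; apply: near_eq_derive => //.
by apply: open_near_eq Ux.
Qed.

Lemma Ck_on_ext n U f g : open U -> {in U, f =1 g} -> Ck_on n U f ->
  Ck_on n U g.
Proof.
move=> oU; elim: n f g => //= n IH f g fg [df sf]; split.
  move=> x Ux; apply: near_eq_derivable (df x Ux).
  exact: open_near_eq Ux.
exact: IH (derive1_eq_on oU fg) sf.
Qed.

Lemma smooth_on_ext U f g : open U -> {in U, f =1 g} -> smooth_on U f ->
  smooth_on U g.
Proof.
by move=> oU fg /smooth_onP sf; apply/smooth_onP => n; apply: Ck_on_ext (sf n).
Qed.

Lemma smooth_on_sub U V f : V `<=` U -> smooth_on U f -> smooth_on V f.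
Proof. by move=> VU [sf]; constructor=> n x /VU; exact: sf. Qed.

Lemma smooth_on_derivable U f x : smooth_on U f -> U x -> derivable f x 1.
Proof. by move=> [sf] Ux; exact: (sf 0%N). Qed.

Lemma smooth_on_derive1 U f : smooth_on U f -> smooth_on U (derive1 f).
Proof. by move=> [sf]; constructor=> n x Ux; rewrite -derive1Sn; exact: sf. Qed.

Lemma is_derive_derive1 f (x : R) : derivable f x 1 -> is_derive x 1 f (derive1 f x).
Proof. by rewrite derive1E => /derivableP. Qed.

Lemma smooth_on_is_derive U f x : smooth_on U f -> U x ->
  is_derive x 1 f (derive1 f x).
Proof. by move=> sf Ux; apply/is_derive_derive1/(smooth_on_derivable sf Ux). Qed.

Lemma is_derive1_val f (x a : R) : is_derive x 1 f a -> derive1 f x = a.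
Proof. by move=> fa; rewrite derive1E; apply: derive_val. Qed.

(** The common induction step of the closure lemmas. Openness of [U] is what lets a formula for the
    derivative valid only on [U] be differentiated again. *)
Lemma Ck_on_is_derive n U f g : open U ->
  (forall x, U x -> is_derive x 1 f (g x)) -> Ck_on n U g -> Ck_on n.+1 U f.
Proof.
move=> oU fg sg /=; split=> [x Ux|]; first by have [] := fg x Ux.
by apply: Ck_on_ext sg => // x /set_mem Ux; rewrite (is_derive1_val (fg x Ux)).
Qed.

Lemma smooth_on_cst U (a : R) : open U -> smooth_on U (fun=> a).
Proof.
move=> oU; apply/smooth_onP => n; elim: n a => [//|n IH] a.
exact: Ck_on_is_derive oU (fun x _ => is_derive_cst a x 1) (IH 0).
Qed.

Lemma smooth_on_id U : open U -> smooth_on U id.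
Proof.
move=> oU; apply/smooth_onP => -[|n] //.
apply: (Ck_on_is_derive oU (fun x _ => is_derive_id x 1)).
exact: smooth_on_Ck (smooth_on_cst 1 oU).
Qed.

Lemma Ck_onD n U f g : open U -> Ck_on n U f -> Ck_on n U g ->
  Ck_on n U (fun x => f x + g x).
Proof.
move=> oU; elim: n f g => // n IH f g /= [df sf] [dg sg].
apply: Ck_on_is_derive oU _ (IH _ _ sf sg) => x Ux.
exact: is_deriveD (is_derive_derive1 (df x Ux)) (is_derive_derive1 (dg x Ux)).
Qed.

Lemma is_deriveM1 f g (x a b : R) : is_derive x 1 f a -> is_derive x 1 g b ->
  is_derive x 1 (fun x => f x * g x) (a * g x + f x * b).
Proof.
move=> fa gb; apply: is_derive_eq (is_deriveM fa gb) _.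
by rewrite /GRing.scale /=; ring.
Qed.

Lemma Ck_onM n U f g : open U -> Ck_on n U f -> Ck_on n U g ->
  Ck_on n U (fun x => f x * g x).
Proof.
move=> oU; elim: n f g => // n IH f g sf sg; have [[df sf'] [dg sg']] := (sf, sg).
apply: (@Ck_on_is_derive n U _ (fun x => derive1 f x * g x + f x * derive1 g x)) => //.
  move=> x Ux; apply: is_deriveM1; apply: is_derive_derive1; [exact: df|exact: dg].
by apply: Ck_onD => //; apply: IH => //; apply: Ck_onS.
Qed.

Lemma Ck_on_comp n U V f g : open U -> open V -> (forall x, U x -> V (g x)) ->
  Ck_on n V f -> Ck_on n U g -> Ck_on n U (fun x => f (g x)).
Proof.
move=> oU oV UV; elim: n f => // n IH f sf sg; have [[df sf'] [dg sg']] := (sf, sg).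
apply: (@Ck_on_is_derive n U _ (fun x => derive1 f (g x) * derive1 g x)) => //.
  move=> x Ux; apply: is_derive1_comp; apply: is_derive_derive1.
  - by apply: df; exact: UV.
  - exact: dg.
by apply: Ck_onM => //; apply: IH => //; exact: Ck_onS.
Qed.

Lemma smooth_onD U f g : open U -> smooth_on U f -> smooth_on U g ->
  smooth_on U (fun x => f x + g x).
Proof.
move=> oU /smooth_onP sf /smooth_onP sg; apply/smooth_onP => n; exact: Ck_onD.
Qed.

Lemma smooth_onM U f g : open U -> smooth_on U f -> smooth_on U g ->
  smooth_on U (fun x => f x * g x).
Proof.
move=> oU /smooth_onP sf /smooth_onP sg; apply/smooth_onP => n; exact: Ck_onM.
Qed.

Lemma smooth_on_comp U V f g : open U -> open V -> (forall x, U x -> V (g x)) ->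
  smooth_on V f -> smooth_on U g -> smooth_on U (fun x => f (g x)).
Proof.
move=> oU oV UV /smooth_onP sf /smooth_onP sg; apply/smooth_onP => n.
exact: Ck_on_comp (sf n) (sg n).
Qed.

Lemma open_neq0 : open [set x : R | x != 0].
Proof. exact: open_neq. Qed.

Lemma smooth_on_inv : smooth_on [set x : R | x != 0] (fun x => x^-1).
Proof.
apply/smooth_onP => n; elim: n => // n IH.
apply: (@Ck_on_is_derive n _ _ (fun x => -1 * (x^-1 * x^-1))).
- exact: open_neq0.
- move=> x /= x0; apply: is_derive_eq (is_deriveV x0 (is_derive_id x 1)) _.
  by rewrite /GRing.scale /= -exprVn expr2; ring.
- apply: Ck_onM; [exact: open_neq0| |]; last by apply: Ck_onM => //; exact: open_neq0.
  exact: smooth_on_Ck (smooth_on_cst _ open_neq0).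
Qed.

Lemma open_gt0 : open [set x : R | 0 < x].
Proof. exact: open_gt. Qed.

Lemma smooth_on_ln : smooth_on [set x : R | 0 < x] (@ln R).
Proof.
apply/smooth_onP => -[|n] //.
apply: (@Ck_on_is_derive n _ _ (fun x => x^-1)); first exact: open_gt0.
by apply: smooth_on_Ck; apply: (smooth_on_sub _ smooth_on_inv) => x /= /lt0r_neq0.
Qed.

Lemma smooth_on_expR : smooth_on setT (@expR R).
Proof.
apply/smooth_onP => n; elim: n => // n IH.
by apply: Ck_on_is_derive IH; exact: openT.
Qed.

Lemma Ck_on_sincos n : Ck_on n setT (@sin R) /\ Ck_on n setT (@cos R).
Proof.
elim: n => // n [IHs IHc]; split.
  by apply: Ck_on_is_derive IHc; exact: openT.
apply: (@Ck_on_is_derive n _ _ (fun x => -1 * sin x)); first exact: openT.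
  by move=> x _; apply: is_derive_eq (is_derive_cos x) _; rewrite mulN1r.
apply: Ck_onM => //; first exact: openT.
exact: smooth_on_Ck (smooth_on_cst _ openT).
Qed.

Lemma smooth_on_sin : smooth_on setT (@sin R).
Proof. by apply/smooth_onP => n; have [] := Ck_on_sincos n. Qed.

Lemma smooth_on_cos : smooth_on setT (@cos R).
Proof. by apply/smooth_onP => n; have [] := Ck_on_sincos n. Qed.

(** The open sets [U] and the complement of [K] cover the line, and [f] is locally zero on the
    second. *)
Lemma smooth_on_extend0 U (K : set R) f : open U -> closed K -> K `<=` U ->
  smooth_on U f -> (forall x, ~ K x -> f x = 0) -> smooth_on setT f.
Proof.
move=> oU cK KU [sf] f0; constructor=> n x _.
have [Kx|nKx] := pselect (K x); first exact/sf/KU.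
have oCK : open (~` K) by exact: closed_openC.
have : smooth_on (~` K) f.
  apply: (smooth_on_ext oCK _ (smooth_on_cst 0 oCK)) => y /set_mem nKy.
  by rewrite f0.
by case; exact.
Qed.

End SmoothOn.

(** * Families of smooth functions with uniformly bounded first derivatives *)

Section UniformBounds.
Context {R : realType} {I : Type} (U : set R).
Hypothesis oU : open U.
Implicit Types F G : I -> R -> R.

Definition ubounded F : Prop :=
  exists B : R, forall i x, U x -> `|F i x| <= B.

(** One derivative suffices because the distribution is paired through its first antiderivative.
    Boundedness of the values is kept apart on purpose: the phases [ln (q Q * w Q z)] are unbounded
    in [Q], while their derivatives in [z] are bounded. *)
Record tame F : Prop := Tame {
  tame_smooth : forall i, smooth_on U (F i);
  tame_derive : ubounded (fun i => derive1 (F i)) }.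

Lemma ubounded_ge0 F : ubounded F ->
  exists2 B : R, 0 <= B & forall i x, U x -> `|F i x| <= B.
Proof.
move=> [B FB]; exists (Num.max 0 B); first by rewrite le_max lexx.
by move=> i x Ux; rewrite le_max FB ?orbT.
Qed.

Lemma uboundedD F G : ubounded F -> ubounded G ->
  ubounded (fun i x => F i x + G i x).
Proof.
move=> [A FA] [B GB]; exists (A + B) => i x Ux.
by rewrite (le_trans (ler_normD _ _))// lerD ?FA ?GB.
Qed.

Lemma uboundedM F G : ubounded F -> ubounded G ->
  ubounded (fun i x => F i x * G i x).
Proof.
move=> [A FA] [B GB]; exists (A * B) => i x Ux.
by rewrite normrM ler_pM ?FA ?GB.
Qed.

Lemma ubounded_eq F G : (forall i x, U x -> F i x = G i x) -> ubounded F ->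
  ubounded G.
Proof. by move=> FG [B FB]; exists B => i x Ux; rewrite -FG ?FB. Qed.

Lemma ubounded_cst (a : R) : ubounded (fun _ _ => a).
Proof. by exists `|a|. Qed.

Lemma tame_is_derive F i x : tame F -> U x ->
  is_derive x 1 (F i) (derive1 (F i) x).
Proof. by move=> [sF _] Ux; exact: smooth_on_is_derive (sF i) Ux. Qed.

Lemma tame_ext F G : (forall i x, U x -> F i x = G i x) -> tame F -> tame G.
Proof.
move=> FG [sF dF]; split=> [i|].
  by apply: (smooth_on_ext oU _ (sF i)) => x /set_mem; exact: FG.
apply: ubounded_eq dF => i x Ux.
by apply: (derive1_eq_on oU) => [y /set_mem|]; [exact: FG|exact: mem_set].
Qed.

Lemma tame_affine (s b : I -> R) : (exists B : R, forall i, `|s i| <= B) ->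
  tame (fun i x => s i * x + b i).
Proof.
move=> [B sB]; split=> [i|].
  apply: smooth_onD => //; last exact: smooth_on_cst.
  by apply: smooth_onM => //; [exact: smooth_on_cst|exact: smooth_on_id].
exists B => i x Ux.
have d := is_deriveD (is_deriveM1 (is_derive_cst (s i) x 1) (is_derive_id x 1))
                     (is_derive_cst (b i) x 1).
by rewrite (is_derive1_val d) mul0r add0r mulr1 addr0 sB.
Qed.

Lemma tame_cst (a : I -> R) : tame (fun i _ => a i).
Proof.
split=> [i|]; first exact: smooth_on_cst.
by exists 0 => i x Ux; rewrite derive1_cst normr0.
Qed.

Lemma tameD F G : tame F -> tame G -> tame (fun i x => F i x + G i x).
Proof.
move=> tF tG; split=> [i|].
  by apply: smooth_onD => //; [case: tF|case: tG].
apply: ubounded_eq (uboundedD (tame_derive tF) (tame_derive tG)) => i x Ux.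
apply/esym/is_derive1_val.
exact: is_deriveD (tame_is_derive i tF Ux) (tame_is_derive i tG Ux).
Qed.

Lemma tameM F G : tame F -> tame G -> ubounded F -> ubounded G ->
  tame (fun i x => F i x * G i x).
Proof.
move=> tF tG bF bG; split=> [i|].
  by apply: smooth_onM => //; [case: tF|case: tG].
have b := uboundedD (uboundedM (tame_derive tF) bG)
                    (uboundedM bF (tame_derive tG)).
apply: ubounded_eq b => i x Ux; apply/esym/is_derive1_val.
exact: is_deriveM1 (tame_is_derive i tF Ux) (tame_is_derive i tG Ux).
Qed.

Lemma uboundedZ (a : R) F : ubounded F -> ubounded (fun i x => a * F i x).
Proof. by move=> bF; exact: uboundedM (ubounded_cst a) bF. Qed.

Lemma tameZ (a : R) F : tame F -> tame (fun i x => a * F i x).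
Proof.
move=> tF; split=> [i|].
  by apply: smooth_onM => //; [exact: smooth_on_cst|case: tF].
apply: ubounded_eq (uboundedZ a (tame_derive tF)) => i x Ux.
apply/esym/is_derive1_val.
have d := is_deriveM1 (is_derive_cst a x 1) (tame_is_derive i tF Ux).
by apply: is_derive_eq d _; rewrite mul0r add0r.
Qed.

Lemma tame_comp (V : set R) (f : R -> R) F : open V -> smooth_on V f ->
  (forall i x, U x -> V (F i x)) ->
  ubounded (fun i x => derive1 f (F i x)) -> tame F ->
  tame (fun i x => f (F i x)).
Proof.
move=> oV sf FV bf tF; split=> [i|].
  by apply: smooth_on_comp (FV i) sf _ => //; case: tF.
apply: ubounded_eq (uboundedM bf (tame_derive tF)) => i x Ux.
apply/esym/is_derive1_val.
apply: is_derive1_comp (tame_is_derive i tF Ux).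
exact: smooth_on_is_derive sf (FV i x Ux).
Qed.

Lemma tame_sin F : tame F -> tame (fun i x => sin (F i x)).
Proof.
apply: (@tame_comp setT (@sin R)) => //; [exact: openT|exact: smooth_on_sin|].
exists 1 => i x _; rewrite (is_derive1_val (is_derive_sin _)).
by rewrite ler_norml cos_geN1 cos_le1.
Qed.

Lemma ubounded_sin F : ubounded (fun i x => sin (F i x)).
Proof. by exists 1 => i x _; rewrite ler_norml sin_geN1 sin_le1. Qed.

Lemma tame_expR F : tame F -> ubounded F -> tame (fun i x => expR (F i x)).
Proof.
move=> tF [B FB]; apply: (@tame_comp setT (@expR R)) tF => //.
- exact: openT.
- exact: smooth_on_expR.
exists (expR B) => i x Ux; rewrite (is_derive1_val (is_derive_expR _)).
rewrite ger0_norm ?expR_ge0// ler_expR.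
exact: le_trans (ler_norm _) (FB i x Ux).
Qed.

Lemma ubounded_expR F : ubounded F -> ubounded (fun i x => expR (F i x)).
Proof.
move=> [B FB]; exists (expR B) => i x Ux.
rewrite ger0_norm ?expR_ge0// ler_expR.
exact: le_trans (ler_norm _) (FB i x Ux).
Qed.

Lemma tame_inv F (m : R) : 0 < m -> (forall i x, U x -> m <= `|F i x|) ->
  tame F -> tame (fun i x => (F i x)^-1).
Proof.
move=> m0 mF tF.
have F0 i x : U x -> F i x != 0.
  by move=> Ux; rewrite -normr_gt0 (lt_le_trans m0)// mF.
apply: (@tame_comp _ (fun x => x^-1)) F0 _ tF.
- exact: open_neq0.
- exact: smooth_on_inv.
exists (m^-1 * m^-1) => i x Ux.
have Fx0 : F i x != 0 by rewrite -normr_gt0 (lt_le_trans m0)// mF.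
rewrite (is_derive1_val (is_deriveV Fx0 (is_derive_id _ _))).
rewrite /GRing.scale /= mulr1 normrN normrV ?unitfE ?expf_neq0// normrX.
by rewrite -exprVn expr2 ler_pM// lef_pV2 ?posrE ?normr_gt0// mF.
Qed.

Lemma ubounded_inv F (m : R) : 0 < m -> (forall i x, U x -> m <= `|F i x|) ->
  ubounded (fun i x => (F i x)^-1).
Proof.
move=> m0 mF; exists m^-1 => i x Ux.
have Fx0 : 0 < `|F i x| by rewrite (lt_le_trans m0)// mF.
by rewrite normrV ?unitfE -?normr_gt0// lef_pV2 ?posrE// mF.
Qed.

Lemma tame_ln F : (forall i x, U x -> 1 <= F i x) -> tame F ->
  tame (fun i x => ln (F i x)).
Proof.
move=> F1 tF; apply: (@tame_comp _ (@ln R)) tF => //.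
- exact: open_gt0.
- exact: smooth_on_ln.
- by move=> i x Ux /=; rewrite (lt_le_trans ltr01)// F1.
exists 1 => i x Ux; have F1x := F1 i x Ux.
have F0 : 0 < F i x by rewrite (lt_le_trans ltr01).
rewrite (is_derive1_val (is_derive1_ln F0)) ger0_norm; last by rewrite invr_ge0 ltW.
by rewrite invf_le1.
Qed.

Lemma ubounded_ln F : (forall i x, U x -> 1 <= F i x) -> ubounded F ->
  ubounded (fun i x => ln (F i x)).
Proof.
move=> F1 [B FB]; exists (ln B) => i x Ux; have F1x := F1 i x Ux.
have F0 : 0 < F i x by rewrite (lt_le_trans ltr01).
have FBx : F i x <= B by rewrite (le_trans (ler_norm _))// FB.
by rewrite ger0_norm ?ln_ge0// ler_ln ?posrE// (lt_le_trans F0).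
Qed.

End UniformBounds.

(** * Pairing the derivative of a continuous function with a localized test function *)

Section Pairing.
Context {R : realType}.
Notation mu := (@lebesgue_measure R).
Implicit Types (f eta : R -> R).

Lemma Rintegral_supp f (x0 e : R) : (forall x, e < `|x - x0| -> f x = 0) ->
  \int[mu]_x f x = \int[mu]_(x in `[x0 - e, x0 + e]) f x.
Proof.
move=> f0; rewrite [RHS]Rintegral_mkcond; apply: eq_Rintegral => x _.
rewrite patchE; case: ifPn => // /negP xD; apply: f0; rewrite ltNge.
apply/negP => xe; apply: xD; rewrite mem_setE/= in_itv/=.
by rewrite -ler_distl.
Qed.

Lemma continuous_itv_integrable f (a b : R) : continuous f ->
  mu.-integrable `[a, b] (EFin \o f).
Proof.
move=> cf; apply: continuous_compact_integrable; first exact: segment_compact.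
exact: continuous_subspaceT.
Qed.

Lemma Rintegral_bound_itv f (x0 e c : R) : 0 <= e -> continuous f ->
  (forall x, `|x - x0| <= e -> `|f x| <= c) ->
  `|\int[mu]_(x in `[x0 - e, x0 + e]) f x| <= c * (2 * e).
Proof.
move=> e0 cf fc.
have intf := continuous_itv_integrable (x0 - e) (x0 + e) cf.
apply: (le_trans (le_normr_Rintegral _ intf)) => //.
have cn : continuous (fun x => `|f x|).
  by move=> x; apply: continuous_comp; [exact: cf|exact: norm_continuous].
apply: (@le_trans _ _ (\int[mu]_(x in `[x0 - e, x0 + e]) c)).
  apply: le_Rintegral => //.
  - exact: continuous_itv_integrable cn.
  - exact: continuous_itv_integrable (@cst_continuous _ _ c).
  - by move=> x /=; rewrite in_itv/= -ler_distl => /fc.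
rewrite Rintegral_cst//= lebesgue_measure_itv/= lte_fin.
case: ifPn => h /=; last by rewrite mulr0 mulr_ge0// ?mulr_ge0// (le_trans _ (fc x0 _))// subrr normr0.
suff -> : x0 + e - (x0 - e) = 2 * e by [].
by ring.
Qed.

Lemma smooth_continuous f : smooth_on setT f -> continuous f.
Proof.
move=> sf x; apply: differentiable_continuous; apply/derivable1_diffP.
exact: smooth_on_derivable sf I.
Qed.

Lemma csmooth_real f : smooth_on setT f -> csmooth (fun x => (f x)%:C).
Proof.
move=> [sf] n x; split; first exact: sf.
by have [s0] := @smooth_on_cst R setT 0 openT; exact: s0.
Qed.

Lemma test_onP (U : set R) (K : set R) f : compact K -> K `<=` U ->
  smooth_on setT f -> (forall x, ~ K x -> f x = 0) ->
  test_on U (fun x => (f x)%:C).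
Proof.
by move=> cK KU sf f0; split; [exact: csmooth_real|exists K; split=> // x /f0 ->].
Qed.

(** After integration by parts the pairing is the integral of [c0 * eta] minus that of [phi * eta'].
    As [eta'] has integral zero, [phi] may be replaced by [phi - phi x0], which is where the
    oscillation bound [L] enters; as [eta] is real, only the real parts of [c0] and [phi]
    contribute. *)
Lemma re_pairing_bound (T : functional R) (c0 : R[i]) (phi : R -> R[i])
    (eta : R -> R) (x0 e B B' L : R) :
  ccontinuous phi ->
  deq_on setT T (dist_add (dist_fun (fun=> c0)) (dderive (dist_fun phi))) ->
  0 < e -> smooth_on setT eta ->
  (forall x, e <= `|x - x0| -> eta x = 0) ->
  (forall x, `|x - x0| <= e -> `|eta x| <= B) ->
  (forall x, `|x - x0| <= e -> `|derive1 eta x| <= B') ->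
  (forall x, `|x - x0| <= e -> `|re (phi x) - re (phi x0)| <= L) ->
  `|re (T (fun x => (eta x)%:C))| <= `|re c0| * (B * (2 * e)) + L * B' * (2 * e).
Proof.
move=> [cphi _] Teq e0 seta eta0 etaB eta'B phiL.
have e0' := ltW e0.
have ceta := smooth_continuous seta.
have ceta' := smooth_continuous (smooth_on_derive1 seta).
have eta'0 x : e < `|x - x0| -> derive1 eta x = 0.
  move=> ex; rewrite (@derive1_eq_on _ [set y | e < `|y - x0|] _ (fun=> 0)).
  - by rewrite derive1_cst.
  - apply: (@open_comp _ _ (fun y => `|y - x0|) [set t | e < t]); last exact: open_gt.
    move=> y _; apply: (@continuous_comp _ _ _ (fun y => y - x0) (fun z : R => `|z|)).
      by apply: cvgB; [exact: cvg_id|exact: cvg_cst].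
    exact: norm_continuous.
  - by move=> y /set_mem /ltW /eta0.
  - exact/mem_set.
have testeta : test (fun x => (eta x)%:C).
  apply: (@test_onP setT `[x0 - e, x0 + e]) => //; first exact: segment_compact.
  move=> x /= /negP; rewrite in_itv/= -ler_distl -ltNge => /ltW; exact: eta0.
rewrite (Teq _ testeta) /dist_add /dderive /dist_fun /cintegral.
have -> (z w : R[i]) : re (z - w) = re z - re w by case: z w => [? ?] [? ?].
rewrite {1 2}/re /=.
have -> : \int[mu]_x re (c0 * (eta x)%:C) = \int[mu]_x (re c0 * eta x).
  by apply: eq_Rintegral => x _; rewrite /re; case: (c0) => a b /=; rewrite mulr0 subr0.
have -> : \int[mu]_x re (phi x * cderiven 1 (fun x => (eta x)%:C) x) =
    \int[mu]_x (re (phi x) * derive1 eta x).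
  apply: eq_Rintegral => x _; rewrite /cderiven /re; case: (phi x) => a b /=.
  by rewrite derive1_cst mulr0 subr0.
rewrite (Rintegral_supp (x0 := x0) (e := e)); last first.
  by move=> x /ltW /eta0 ->; rewrite mulr0.
rewrite [X in _ - X](Rintegral_supp (x0 := x0) (e := e)); last first.
  by move=> x /eta'0 ->; rewrite mulr0.
rewrite RintegralZl//; last exact: continuous_itv_integrable.
(* [eta] vanishes also at the two endpoints, since its vanishing is assumed for [e <= |x - x0|],
   equality included. *)
have int0 : \int[mu]_(x in `[x0 - e, x0 + e]) derive1 eta x = 0.
  rewrite /Rintegral (@continuous_FTC2 _ _ eta)/=.
  - rewrite eta0; last by rewrite addrAC subrr add0r ger0_norm.
    rewrite eta0; last by rewrite addrAC subrr add0r normrN ger0_norm.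
    by rewrite subrr.
  - lra.
  - exact: continuous_subspaceT.
  - split.
    + by move=> x _; exact: smooth_on_derivable seta I.
    + by apply: cvg_at_right_filter; exact: ceta.
    + by apply: cvg_at_left_filter; exact: ceta.
  - by [].
have -> : \int[mu]_(x in `[x0 - e, x0 + e]) (re (phi x) * derive1 eta x) =
    \int[mu]_(x in `[x0 - e, x0 + e]) ((re (phi x) - re (phi x0)) * derive1 eta x).
  under [in RHS]eq_Rintegral do rewrite mulrBl.
  rewrite RintegralB//; last 2 first.
  - apply: continuous_itv_integrable => x.
    by apply: cvgM; [exact: cphi|exact: ceta'].
  - apply: continuous_itv_integrable => x.
    by apply: cvgM; [exact: cvg_cst|exact: ceta'].
  rewrite [X in _ = _ - X]RintegralZl//; last exact: continuous_itv_integrable.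
  by rewrite int0 mulr0 subr0.
apply: (le_trans (ler_normB _ _)); apply: lerD.
  rewrite normrM ler_wpM2l//; apply: Rintegral_bound_itv => //.
apply: Rintegral_bound_itv => //.
- move=> x; apply: cvgM; last exact: ceta'.
  by apply: cvgB; [exact: cphi|exact: cvg_cst].
- by move=> x xe; rewrite normrM ler_pM ?phiL ?eta'B.
Qed.

End Pairing.

(** * Continued fraction expansion of an irrational number by integral matrices *)

Section ContinuedFraction.
Context {R : realType}.

Lemma irrational_neq_frac (x : R) (a b : int) : irrational x -> b != 0 ->
  x * b%:~R != a%:~R.
Proof.
move=> ix b0; apply/eqP => xab; apply: ix.
exists (a%:~R / b%:~R) => //.
by rewrite fmorph_div/= !ratr_int -xab mulfK// intr_eq0.
Qed.

Lemma floor_irrational (y : R) : (forall a : int, y != a%:~R) ->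
  exists n : int, [/\ n%:~R < y, 1 < (y - n%:~R)^-1 & y = n%:~R + ((y - n%:~R)^-1)^-1].
Proof.
move=> yN; exists (Num.floor y); have /andP[ny yn] := floor_itv y.
have n0 : 0 < y - (Num.floor y)%:~R.
  by rewrite subr_gt0 lt_neqAle ny eq_sym yN.
split; first by rewrite -subr_gt0.
  by rewrite invf_gt1// ltrBlDl -intrD1.
by rewrite invrK addrC subrK.
Qed.

(** One step of the continued fraction, cleared of denominators: the matrix with rows (p, r), (q, s)
    is multiplied on the right by the one with rows (n, 1), (1, 0). *)
Lemma mobius_eq_addV (x y n z p r q s : R) : z != 0 -> y = n + z^-1 ->
  x * (q * y + s) = p * y + r ->
  x * ((q * n + s) * z + q) = (p * n + r) * z + p.
Proof.
move=> z0 yz xy.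
have yzE : y * z = n * z + 1 by rewrite yz mulrDl mulVf.
transitivity (x * (q * y + s) * z).
  by rewrite -mulrA (mulrDl (q * y)) -(mulrA q y) yzE; ring.
by rewrite xy mulrDl -mulrA yzE; ring.
Qed.

(* Two steps of the continued fraction of x0 at once, so that the determinant
   stays 1. *)
Lemma convergent_matrix (x0 : R) (Q : nat) : irrational x0 ->
  exists (p r q s : int) (y : R),
    [/\ p * s - r * q = 1, Q%:Z < q, 0 <= s <= q, 1 < y &
        x0 * (q%:~R * y + s%:~R) = p%:~R * y + r%:~R].
Proof.
move=> ix.
(* The expansion never stops: an integral [y] would make [x0] a quotient of integers. *)
have nint (p r q s : int) (y : R) : 0 <= q -> 0 <= s -> (q != 0) || (s != 0) ->
    1 < y -> x0 * (q%:~R * y + s%:~R) = p%:~R * y + r%:~R ->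
    forall a : int, y != a%:~R.
  move=> q0 s0 qs y1 xy a; apply/eqP => ya; move: xy.
  rewrite ya -!intrM -!intrD; apply/eqP/irrational_neq_frac => //.
  have a1 : 1 < a by rewrite -(ltr_int R) -ya.
  by apply/eqP => qas; move: qs; nia.
(* Both partial quotients [n] and [m] are at least 1, so the new denominator [(q * n + s) * m + q]
   is at least [2q + s]; this drives the growth in [Q]. *)
have step (p r q s : int) (y : R) : p * s - r * q = 1 -> 0 <= q ->
    0 <= s -> 1 < y -> x0 * (q%:~R * y + s%:~R) = p%:~R * y + r%:~R ->
    exists (p' r' q' s' : int) (y' : R),
    [/\ p' * s' - r' * q' = 1, q + q + s <= q', 0 <= s' <= q', 1 < y' &
        x0 * (q'%:~R * y' + s'%:~R) = p'%:~R * y' + r'%:~R].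
  move=> det q0 s0 y1 xy.
  have qs : (q != 0) || (s != 0).
    by rewrite -negb_and; apply/negP => /andP[/eqP qz /eqP sz]; move: det; rewrite qz sz !mulr0.
  have [n [ny z1 yz]] := floor_irrational (nint _ _ _ _ _ q0 s0 qs y1 xy).
  set z := (y - n%:~R)^-1 in z1 yz.
  have n1 : 1 <= n.
    have n0 : 0 < y - n%:~R by rewrite subr_gt0.
    have n1' : y - n%:~R < 1 by rewrite -invf_gt1.
    have : (0 : R) < n%:~R by lra.
    by rewrite ltr0z; lia.
  have z0 : z != 0 by rewrite gt_eqF// (lt_trans ltr01).
  have xz : x0 * ((q * n + s)%:~R * z + q%:~R) = (p * n + r)%:~R * z + p%:~R.
    by rewrite !intrD !intrM; exact: mobius_eq_addV yz xy.
  have qs' : (q * n + s != 0) || (q != 0) by move: qs; nia.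
  have qns : 0 <= q * n + s by nia.
  have [m [mz w1 zw]] := floor_irrational (nint _ _ _ _ _ qns q0 qs' z1 xz).
  set w := (z - m%:~R)^-1 in w1 zw.
  have m1 : 1 <= m.
    have m0 : 0 < z - m%:~R by rewrite subr_gt0.
    have m1' : z - m%:~R < 1 by rewrite -invf_gt1.
    have : (0 : R) < m%:~R by lra.
    by rewrite ltr0z; lia.
  have w0 : w != 0 by rewrite gt_eqF// (lt_trans ltr01).
  exists ((p * n + r) * m + p), (p * n + r), ((q * n + s) * m + q), (q * n + s), w.
  split=> //.
  - by rewrite -[RHS]det; ring.
  - nia.
  - nia.
  rewrite (intrD _ (_ * m) q) (intrD _ (_ * m) p) !(intrM _ _ m).
  exact: mobius_eq_addV zw xz.
elim: Q => [|Q [p [r [q [s [y [det qQ /andP[s0 sq] y1 xy]]]]]]].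
  have xN (a : int) : x0 != a%:~R.
    by have := @irrational_neq_frac x0 a 1 ix isT; rewrite mulr1.
  have [n [nx z1 xz]] := floor_irrational xN.
  (* The start is the translation by [n - 1] rather than by the floor [n], so that
     [y = x0 - (n - 1)] exceeds 1. One double step then makes the denominator positive. *)
  have [] := @step 1 (n - 1) 0 1 (x0 - (n - 1)%:~R).
  - by rewrite mulr0 mul1r subr0.
  - by [].
  - by [].
  - rewrite intrB; lra.
  - by rewrite mul0r add0r !mul1r mulr1 subrK.
  move=> p [r [q [s [y [det qq sq y1 xy]]]]].
  by exists p, r, q, s, y; split=> //; lia.
have q0 : 0 <= q by lia.
have [p' [r' [q' [s' [y' [det' qq sq' y1' xy']]]]]] := step _ _ _ _ _ det q0 s0 y1 xy.
by exists p', r', q', s', y'; split=> //; lia.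
Qed.

End ContinuedFraction.

(** * Elements of the group that carry a fixed interval close to the irrational point *)

Section Renormalization.
Context {R : realType}.

(** Pigeonhole principle. Otherwise every [t] in [F] fails at some [n], hence at all larger ones,
    and at the maximum of these finitely many thresholds no [t] is left. *)
Lemma finite_set_frequently (T : eqType) (F : set T) (P : T -> nat -> Prop) :
  finite_set F -> (forall t m n, (m <= n)%N -> P t n -> P t m) ->
  (forall n, exists2 t, F t & P t n) -> exists2 t, F t & forall n, P t n.
Proof.
move=> /finite_seqP[s ->] Pmono Pex; apply: contrapT => nP.
have {}nP t : t \in s -> exists n, ~ P t n.
  by move=> ts; apply/existsNP => Pt; apply: nP; exists t.
suff [n nPn] : exists n, forall t, t \in s -> ~ P t n.
  by have [t ts] := Pex n; exact: nPn.
elim: s nP {Pex} => [|t s IH] nP; first by exists 0%N.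
have [|m mP] := IH; first by move=> u us; apply: nP; rewrite inE us orbT.
have [|k kP] := nP t; first by rewrite inE eqxx.
exists (maxn m k) => u; rewrite inE => /predU1P[->|us] Pu.
  by apply: kP; apply: Pmono Pu; exact: leq_maxr.
by apply: mP us _; apply: Pmono Pu; exact: leq_maxl.
Qed.

Lemma mulmx2 (K : pzRingType) (a b c d a' b' c' d' : K) :
  mx2 a b c d *m mx2 a' b' c' d' =
  mx2 (a * a' + b * c') (a * b' + b * d') (c * a' + d * c') (c * b' + d * d').
Proof.
apply/matrixP => i j; rewrite !mxE big_ord_recl big_ord1 !mxE /=.
by case: i => [[|[|//]] /= ?]; case: j => [[|[|//]] /= ?].
Qed.

Lemma det_mx2 (K : comPzRingType) (a b c d : K) :
  \det (mx2 a b c d) = a * d - b * c.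
Proof.
rewrite (expand_det_row _ 0) big_ord_recl big_ord1 /cofactor !det_mx11 !mxE /=.
by rewrite expr0 mul1r /bump /= expr1 mulN1r mulrN.
Qed.

Lemma invmx_mx2 (K : comUnitRingType) (a b c d : K) : a * d - b * c = 1 ->
  invmx (mx2 a b c d) = mx2 d (- b) (- c) a.
Proof.
move=> det1; have u : mx2 a b c d \in unitmx.
  by rewrite unitmxE det_mx2 det1 unitr1.
apply: (can_inj (mulKmx u)); rewrite mulmxV// mulmx2.
apply/matrixP => i j; rewrite !mxE.
case: i => [[|[|//]] /= ?]; case: j => [[|[|//]] /= ?] /=; rewrite ?mulr1n ?mulr0n.
- by rewrite -det1; ring.
- by ring.
- by ring.
- by rewrite -det1; ring.
Qed.

(** By the determinant relation the difference of the images of [y] and [y0] is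
    [(y - y0) / ((q y + s) (q y0 + s))]. The denominator is at least [q^2 y y0], and
    [|y - y0| <= 2 y y0] since both are at least 1. *)
Lemma mobius_convergent_dist (x0 p r q s y0 y : R) : p * s - r * q = 1 ->
  0 < q -> 0 <= s -> 1 < y0 -> x0 * (q * y0 + s) = p * y0 + r -> 1 <= y ->
  `|(p * y + r) / (q * y + s) - x0| <= 2 / q ^+ 2.
Proof.
move=> det q0 s0 y01 xy y1.
have d0 : 0 < q * y0 + s by nra.
have d1 : 0 < q * y + s by nra.
have -> : x0 = (p * y0 + r) / (q * y0 + s) by rewrite -xy mulfK// gt_eqF.
have -> : (p * y + r) / (q * y + s) - (p * y0 + r) / (q * y0 + s) =
    (y - y0) / ((q * y + s) * (q * y0 + s)).
  rewrite -[y - y0]mul1r -det; field.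
  by rewrite !gt_eqF.
rewrite normrM normfV (gtr0_norm (mulr_gt0 d1 d0)).
rewrite ler_pdivrMr ?mulr_gt0// mulrAC ler_pdivlMr ?exprn_gt0//.
have : q * y * (q * y0) <= (q * y + s) * (q * y0 + s).
  by apply: ler_pM; [nra|nra|lra|lra].
have : `|y - y0| <= 2 * (y * y0) by rewrite ler_norml; apply/andP; split; nra.
move=> h1 h2; have q20 : 0 < q ^+ 2 by rewrite exprn_gt0.
apply: (le_trans (ler_wpM2r (ltW q20) h1)); rewrite -mulrA ler_wpM2l//.
by apply: le_trans h2; rewrite le_eqVlt; apply/orP; left; apply/eqP; ring.
Qed.

Lemma renormalized_slope_le (q s q1 s1 a : R) : 0 < q -> 0 <= s <= q ->
  0 <= s1 <= q1 -> 0 <= a ->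
  `|q * s1 - (q * a + s) * q1| <= q * (q1 * (a + 2)).
Proof.
move=> q0 /andP[s0 sq] /andP[s10 sq1] a0.
have q10 : 0 <= q1 := le_trans s10 sq1.
have h1 : 0 <= q * s1 by rewrite mulr_ge0// ltW.
have h2 : q * s1 <= q * q1 by rewrite ler_wpM2l// ltW.
have h3 : 0 <= s * q1 by rewrite mulr_ge0.
have h4 : s * q1 <= q * q1 by rewrite ler_wpM2r.
have h5 : 0 <= q * q1 * a by rewrite !mulr_ge0// ltW.
by rewrite ler_norml; apply/andP; split; lra.
Qed.

(** The middle expression is the negated denominator of the matrix [H a] built below. Since
    [t <= 2e] and [a >= 3], at least [e q] remains after the subtraction. *)
Lemma renormalized_den_bounds (q s e t a : R) : 0 < q -> 0 <= s <= q ->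
  1 <= e -> 0 <= t <= 2 * e -> 3 <= a ->
  q <= e * (q * a + s) - q * t <= q * (e * (a + 1)).
Proof.
move=> q0 /andP[s0 sq] e1 /andP[t0 te] a3.
have e0 : 0 <= e := le_trans ler01 e1.
have h1 : 0 <= q * t by rewrite mulr_ge0// ltW.
have h2 : q * t <= q * (2 * e) by rewrite ler_wpM2l// ltW.
have h3 : 0 <= e * s by rewrite mulr_ge0.
have h4 : e * s <= e * q by rewrite ler_wpM2l.
have h5 : q <= e * q by rewrite ler_peMl// ltW.
have h6 : 3 * (e * q) <= a * (e * q) by rewrite ler_wpM2r// mulr_ge0// ltW.
by apply/andP; split; lra.
Qed.

(** Raising [n] by one adds [e q N] to the denominator [v], and [v] itself lies between [n - 2] and
    [n + 1] times this increment. *)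
Lemma renormalized_den_ratio (q s e t n N v : R) : 0 < q -> 0 <= s <= q ->
  1 <= e -> 0 <= t <= 2 * e -> 3 <= n -> 1 <= N ->
  v = e * (q * (n * N) + s) - q * t ->
  (n + 1)^-1 * v <= e * q * N <= (n - 2)^-1 * v.
Proof.
move=> q0 /andP[s0 sq] e1 /andP[t0 te] n3 N1 ->.
have e0 : 0 <= e := le_trans ler01 e1.
have h1 : 0 <= q * t by rewrite mulr_ge0// ltW.
have h2 : q * t <= q * (2 * e) by rewrite ler_wpM2l// ltW.
have h3 : 0 <= e * s by rewrite mulr_ge0.
have h4 : e * s <= e * q by rewrite ler_wpM2l.
have h5 : e * q <= e * q * N by rewrite ler_peMr// mulr_ge0// ltW.
rewrite !(mulrC _^-1) ler_pdivrMr; last by lra.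
rewrite ler_pdivlMr; last by lra.
by apply/andP; split; lra.
Qed.

(** The constant [M] is to be independent of [q]. The slope bound controls the derivative of the
    denominator divided by [q]; the denominators of the matrices constructed below are negative,
    whence the sign. *)
Record renormalizing (Gamma : set 'M[int]_2) (x0 A M q : R) (H : 'M[int]_2)
    : Prop := Renormalizing {
  renormalizing_in : Gamma H;
  renormalizing_slope : `|real_mx R H 1 0| <= M * q;
  renormalizing_den : forall z, `|z| < A ->
    q <= - mobius_den (real_mx R H) z <= M * q;
  renormalizing_dist : forall z, `|z| < A ->
    `|mobius (real_mx R H) z - x0| <= M / q ^+ 2 }.

Definition convergent (x0 : R) (Q : nat) (g : 'M[int]_2) : Prop :=
  exists (p r q s : int) (y : R),
    [/\ p * s - r * q = 1, Q%:Z < q, 0 <= s <= q, 1 < y &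
        x0 * (q%:~R * y + s%:~R) = p%:~R * y + r%:~R] /\ g = mx2 p r q s.

(** By finite index and the pigeonhole principle a single left coset of [Gamma] contains matrices
    with arbitrarily large [q]. Writing [g = g1 h] with [h] in [Gamma], normality puts [g1 h g1^-1]
    in [Gamma]. *)
Lemma convergent_same_coset (Gamma : set 'M[int]_2) (x0 : R) :
  normal_finite_index Gamma -> irrational x0 ->
  exists2 g1 : 'M[int]_2, convergent x0 0 g1 &
    forall Q, exists2 g, convergent x0 Q g & Gamma (g *m invmx g1).
Proof.
move=> [GSL G1 [GM GV] Gconj Gfin] ix.
have convSL Q g : convergent x0 Q g -> SL2Z g.
  by move=> [p [r [q [s [y [[det _ _ _ _] ->]]]]]]; rewrite /SL2Z/= det_mx2.
have SLunit g : SL2Z g -> g \in unitmx by move=> g1; rewrite unitmxE g1 unitr1.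
pose P (K : set 'M[int]_2) Q := exists2 g, convergent x0 Q g &
  K = [set g *m h | h in Gamma].
have [K _ KP] : exists2 K, [set [set g *m h | h in Gamma] | g in SL2Z] K &
    forall Q, P K Q.
  apply: finite_set_frequently => //.
  - move=> K m n mn [g [p [r [q [s [y [[det nq sq y1 xy] gE]]]]]] KE].
    by exists g => //; exists p, r, q, s, y; split=> //; split=> //; lia.
  - move=> Q; have [p [r [q [s [y conv]]]]] := convergent_matrix Q ix.
    have cg : convergent x0 Q (mx2 p r q s) by exists p, r, q, s, y.
    exists [set mx2 p r q s *m h | h in Gamma]; last by exists (mx2 p r q s).
    by exists (mx2 p r q s) => //; exact: convSL cg.
have [g1 cg1 Kg1] := KP 0%N.
exists g1 => // Q; have [g cg Kg] := KP Q; exists g => //.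
have : K g by rewrite Kg; exists 1%:M; rewrite ?mulmx1.
rewrite Kg1 => -[h Gh <-]; apply: Gconj => //; exact: convSL cg1.
Qed.

(** With [T] the unit translation, the matrices are [g T^(kN) g1^-1 T^b] for [k = n] and
    [k = n + 1]. Here [T^b] moves the interval away from the pole of [g1^-1], then [g1^-1] sends it
    into [[-2, 0]], the next translation moves it beyond 1, and [g] contracts it towards [x0]. *)
Lemma renormalizing_matrices (Gamma : set 'M[int]_2) (N : nat) (x0 A : R)
    (n : nat) : normal_finite_index Gamma -> cusp_width Gamma N ->
  irrational x0 -> (3 <= n)%N ->
  exists2 M : R, 0 < M & forall Q : nat, exists (H H' : 'M[int]_2) (q : R),
  [/\ Q%:R < q, renormalizing Gamma x0 A M q H,
      renormalizing Gamma x0 A M q H' &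
      forall z (u := - mobius_den (real_mx R H) z)
          (u' := - mobius_den (real_mx R H') z), `|z| < A ->
        (1 + n.+1%:R^-1) * u <= u' <= (1 + (n.-2)%:R^-1) * u].
Proof.
move=> nG [N0 GN] ix n3.
have [g1 [p1 [r1 [q1 [s1 [y1 [[det1 q10 /andP[s10 sq1] _ _] g1E]]]]]] gP] :=
  convergent_same_coset nG ix.
have [GSL _ [GM GV] Gconj _] := nG.
(* [m] is taken so large that [q1 (z + b) - p1 >= 1] for all [|z| < A]; [b] is a multiple of [N], so
   that the translation by [b] lies in [Gamma]. *)
have [m mA] : exists m : nat, A + `|p1|%:~R + 1 < m%:R :> R.
  by exists (Num.bound `|A + `|p1|%:~R + 1|); rewrite (le_lt_trans (ler_norm _))// archi_boundP.
pose b : int := (m * N)%:Z.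
have GT (a : int) : (N%:Z %| a)%Z -> Gamma (mx2 1 a 0 1) by move/GN.
pose E : R := q1%:~R * (A + b%:~R) + `|p1%:~R|.
(* The three summands serve in turn the distance to [x0], the size of the denominator and its
   slope. *)
pose M : R := 2 + `|E| * (n * N + N + 1)%:R + q1%:~R * (n * N + N + 2)%:R.
have q1R : 1 <= q1%:~R :> R by rewrite (ler_int R 1); lia.
have NR : 1 <= N%:R :> R by rewrite (ler_nat R 1).
have M0 : 0 < M by rewrite /M; have := normr_ge0 E; have := ler0n R (n * N + N + 1);
  have := ler0n R (n * N + N + 2); nra.
have e_bnd z : `|z| < A -> 1 <= q1%:~R * (z + b%:~R) - p1%:~R <= E.
  move=> zA; have /andP[zA1 zA2] : - A < z < A by rewrite -ltr_norml.
  have mb : m%:R <= b%:~R :> R.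
    by rewrite /b -pmulrn ler_nat leq_pmulr.
  have := ler_norm (p1%:~R : R); have := ler_norm (- p1%:~R : R).
  rewrite normrN; rewrite intr_norm in mA => h1 h2.
  by apply/andP; split; rewrite /E; nra.
have det1R : p1%:~R * s1%:~R - r1%:~R * q1%:~R = 1 :> R.
  by rewrite -!intrM -intrB det1.
have s1R : 0 <= s1%:~R :> R by rewrite ler0z.
have sq1R : s1%:~R <= q1%:~R :> R by rewrite ler_int.
have t_bnd z : `|z| < A -> 0 <= s1%:~R * (z + b%:~R) - r1%:~R <=
    2 * (q1%:~R * (z + b%:~R) - p1%:~R).
  move=> /e_bnd; set e := _ - p1%:~R; set t := _ - r1%:~R => /andP[e1 _].
  (* This is the determinant relation of [g1]; with [0 <= s1 <= q1] and [e >= 1] it gives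
     [0 <= t <= 2e]. *)
  have tE : q1%:~R * t = 1 + s1%:~R * e.
    by rewrite -[X in X + _]det1R /t /e; ring.
  by apply/andP; split; nra.
exists M => // Q.
have [g [p [r [q [s [y0 [[det qQ /andP[s0 sq] y01 xy] gE]]]]]] Gg] := gP Q.
have q0 : 0 < q%:~R :> R by rewrite ltr0z; lia.
have detR : p%:~R * s%:~R - r%:~R * q%:~R = 1 :> R.
  by rewrite -!intrM -intrB det.
have s0R : 0 <= s%:~R :> R by rewrite ler0z.
have sqR : s%:~R <= q%:~R :> R by rewrite ler_int.
(* The third factor is the inverse of [g1]. *)
pose H (a : int) : 'M[int]_2 :=
  (mx2 p r q s *m mx2 1 a 0 1) *m (mx2 s1 (- r1) (- q1) p1 *m mx2 1 b 0 1).
have HE a : real_mx R (H a) = mx2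
   (p%:~R * s1%:~R - (p%:~R * a%:~R + r%:~R) * q1%:~R)
   (p%:~R * (s1%:~R * b%:~R - r1%:~R) - (p%:~R * a%:~R + r%:~R) * (q1%:~R * b%:~R - p1%:~R))
   (q%:~R * s1%:~R - (q%:~R * a%:~R + s%:~R) * q1%:~R)
   (q%:~R * (s1%:~R * b%:~R - r1%:~R) - (q%:~R * a%:~R + s%:~R) * (q1%:~R * b%:~R - p1%:~R)).
  rewrite /H !mulmx2; apply/matrixP => i j; rewrite !mxE.
  by case: i => [[|[|//]] /= ?]; case: j => [[|[|//]] /= ?];
    rewrite !(intrD, intrM, intrN); ring.
have GH (k : nat) : Gamma (H (k * N)%:Z).
  rewrite /H mulmxA; apply: (GM); last by apply: GT; rewrite /b PoszM dvdz_mull.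
  have V1 : invmx g1 = mx2 s1 (- r1) (- q1) p1 by rewrite g1E invmx_mx2.
  have u1 : g1 \in unitmx by rewrite g1E unitmxE det_mx2 det1 unitr1.
  rewrite -V1 -gE.
  (* The first factor is in [Gamma] by the choice of [g1], the second because [Gamma] is normal. *)
  have -> (T : 'M[int]_2) : g *m T *m invmx g1 =
      (g *m invmx g1) *m (g1 *m T *m invmx g1) by rewrite !mulmxA mulmxKV.
  apply: (GM) => //; apply: Gconj.
    by rewrite g1E /SL2Z/= det_mx2.
  by apply: GT; rewrite PoszM dvdz_mull.
have denH a z : - mobius_den (real_mx R (H a)) z =
    (q1%:~R * (z + b%:~R) - p1%:~R) * (q%:~R * a%:~R + s%:~R)
    - q%:~R * (s1%:~R * (z + b%:~R) - r1%:~R).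
  by rewrite /mobius_den HE !mxE /=; ring.
have numH a z : - mobius_num (real_mx R (H a)) z =
    (q1%:~R * (z + b%:~R) - p1%:~R) * (p%:~R * a%:~R + r%:~R)
    - p%:~R * (s1%:~R * (z + b%:~R) - r1%:~R).
  by rewrite /mobius_num HE !mxE /=; ring.
have renH (k : nat) : (3 <= k)%N -> (k <= n.+1)%N ->
    renormalizing Gamma x0 A M q%:~R (H (k * N)%:Z).
  move=> k3 kn; have kR : 3 <= (k * N)%:~R :> R.
    by rewrite -pmulrn (ler_nat R 3) (leq_trans k3)// leq_pmulr.
  have kM : (k * N)%:~R + 1 <= (n * N + N + 1)%:R :> R.
    by rewrite -pmulrn natrD lerD2r ler_nat -mulSnr leq_mul2r kn orbT.
  split=> //.
  - rewrite HE mxE /=; set a := ((k * N)%:Z)%:~R in kR kM *.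
    have a0 : 0 <= a := le_trans (ler0n R 3) kR.
    apply: (le_trans (renormalized_slope_le q0 _ _ a0)); rewrite ?s0R ?s1R//.
    rewrite (mulrC M) ler_wpM2l ?(ltW q0)// /M.
    have h1 : a + 2 <= (n * N + N + 2)%:R.
      by move: kM; rewrite !(natrD _ (n * N + N)) lerD2r => h; lra.
    apply: (@le_trans _ _ (q1%:~R * (n * N + N + 2)%:R : R)).
      by rewrite ler_wpM2l// (le_trans ler01).
    by rewrite lerDr addr_ge0// mulr_ge0.
  - move=> z zA; rewrite denH; have /andP[e1 eE] := e_bnd z zA.
    have /andP[t0 te] := t_bnd z zA.
    set e := _ - p1%:~R in e1 eE te *; set t := _ - r1%:~R in t0 te *.
    set a := ((k * N)%:Z)%:~R in kR kM *.
    have /andP[-> /le_trans->//] : q%:~R <= e * (q%:~R * a + s%:~R) - q%:~R * t <=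
        q%:~R * (e * (a + 1)).
      by apply: renormalized_den_bounds; rewrite ?s0R ?t0.
    rewrite (mulrC M) ler_wpM2l ?(ltW q0)// /M.
    apply: (@le_trans _ _ (`|E| * (n * N + N + 1)%:R)).
      apply: ler_pM => //; first by rewrite (le_trans ler01).
        by rewrite addr_ge0// (le_trans _ kR).
      by apply: (le_trans eE); exact: ler_norm.
    by rewrite addrAC lerDr addr_ge0// mulr_ge0// (le_trans ler01).
  - move=> z zA; have /andP[e1 eE] := e_bnd z zA.
    have /andP[t0 te] := t_bnd z zA.
    have dH := denH (k * N)%:Z z; have nH := numH (k * N)%:Z z.
    set e := _ - p1%:~R in e1 eE te dH nH *; set t := _ - r1%:~R in t0 te dH nH *.
    set a := ((k * N)%:Z)%:~R in kR kM dH nH *.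
    have e0 : 0 < e by lra.
    (* [H] sends [z] to the image of [a - t / e] under [g], and [mobius_convergent_dist] applies
       once this argument is at least 1. *)
    have y1' : 1 <= a - t / e.
      have : t / e <= 2 by rewrite ler_pdivrMr.
      by lra.
    have d := mobius_convergent_dist detR q0 s0R y01 xy y1'.
    have -> : mobius (real_mx R (H (k * N)%:Z)) z =
        (p%:~R * (a - t / e) + r%:~R) / (q%:~R * (a - t / e) + s%:~R).
      rewrite /mobius -[mobius_num _ _]opprK -[mobius_den _ _]opprK nH dH.
      rewrite invrN mulrNN.
      have -> : e * (p%:~R * a + r%:~R) - p%:~R * t = e * (p%:~R * (a - t / e) + r%:~R).
        by field; rewrite gt_eqF.
      have -> : e * (q%:~R * a + s%:~R) - q%:~R * t = e * (q%:~R * (a - t / e) + s%:~R).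
        by field; rewrite gt_eqF.
      by rewrite -mulf_div divff ?mul1r// gt_eqF.
    apply: (le_trans d); rewrite ler_wpM2r ?invr_ge0 ?exprn_ge0 ?(ltW q0)// /M.
    by rewrite -addrA lerDl addr_ge0// mulr_ge0// (le_trans ler01).
exists (H (n * N)%:Z), (H (n.+1 * N)%:Z), q%:~R; split.
- by rewrite -[Q%:R]/(Q%:Z%:~R) ltr_int.
- exact: renH.
- by apply: renH => //; exact: leqW.
move=> z u u' zA; rewrite /u /u' !denH.
have /andP[e1 eE] := e_bnd z zA; have /andP[t0 te] := t_bnd z zA.
set e := _ - p1%:~R in e1 eE te *; set t := _ - r1%:~R in t0 te *.
have aE : (n.+1 * N)%:Z%:~R = (n * N)%:Z%:~R + N%:R :> R.
  by rewrite -!pmulrn mulSnr natrD.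
have aN : (n * N)%:Z%:~R = n%:R * N%:R :> R by rewrite -!pmulrn natrM.
rewrite aE aN.
have n2 : n.-2%:R = n%:R - 2 :> R by rewrite -[X in X%:R - _](subnK (ltnW n3)) natrD addrK subn2.
have -> : e * (q%:~R * (n%:R * N%:R + N%:R) + s%:~R) - q%:~R * t =
  (e * (q%:~R * (n%:R * N%:R) + s%:~R) - q%:~R * t) + e * q%:~R * N%:R by ring.
rewrite n2 -natr1 !(mulrDl 1 _) !mul1r !lerD2l.
by apply: renormalized_den_ratio; rewrite ?(ler_nat R 3)//; apply/andP.
Qed.

End Renormalization.

(** * The transformation law on real test functions *)

Section Automorphy.
Context {R : realType}.
Implicit Types (T : functional R) (eta F : R -> R).

Lemma cisD (a b : R) : cis (a + b) = cis a * cis b.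
Proof. by rewrite /cis cosD sinD; simpc; rewrite [X in _ +i* X]addrC. Qed.

Lemma cpowD (r : R) (s t : R[i]) : 0 < r -> cpow r (s + t) = cpow r s * cpow r t.
Proof.
move=> r0; case: s => a b; case: t => c d; rewrite /cpow /re /im /=.
rewrite powRD; last by rewrite (gt_eqF r0) implybT.
by rewrite mulrDl cisD (rmorphM (real_complex R)); ring.
Qed.

Lemma cpow_real (r a : R) : cpow r a%:C = (r `^ a)%:C.
Proof.
rewrite /cpow /re /im /= mul0r /cis cos0 sin0; apply/eqP.
by rewrite eq_complex /=; apply/andP; split; apply/eqP; ring.
Qed.

Lemma is_distribution_scale T (a : R[i]) phi : is_distribution T -> test phi ->
  T (fun x => a * phi x) = a * T phi.
Proof.
move=> [Tlin _] tphi.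
have t0 : test (fun _ : R => 0 : R[i]).
  apply: (@test_onP R setT set0 (fun=> 0)) => //; first exact: compact0.
  exact: smooth_on_cst openT.
have T0 : T (fun=> 0) = 0.
  have := Tlin 1 (fun=> 0) (fun=> 0) t0 t0; rewrite !mul1r addr0.
  by move=> /eqP; rewrite -subr_eq0 opprD addrA subrr sub0r oppr_eq0 => /eqP.
have := Tlin a phi (fun=> 0) tphi t0; rewrite T0 addr0 => <-.
by congr T; apply/funext => x; rewrite addr0.
Qed.

Lemma open_norm_lt (A : R) : open [set z : R | `|z| < A].
Proof.
apply: (@open_comp _ _ (fun z : R => `|z|) [set t | t < A]); last exact: open_lt.
by move=> z _; exact: norm_continuous.
Qed.

Lemma mx2E (K : Type) (g : 'M[K]_2) : g = mx2 (g 0 0) (g 0 1) (g 1 0) (g 1 1).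
Proof.
apply/matrixP => i j; rewrite !mxE.
by case: i => [[|[|//]] /= ?]; case: j => [[|[|//]] /= ?]; congr (g _ _); exact: val_inj.
Qed.

Lemma real_mx_mx2 (a b c d : int) :
  real_mx R (mx2 a b c d) = mx2 a%:~R b%:~R c%:~R d%:~R.
Proof.
apply/matrixP => i j; rewrite !mxE.
by case: i => [[|[|//]] /= ?]; case: j => [[|[|//]] /= ?].
Qed.

Section Pullback.
Variables (a b c d : R).
Hypothesis det1 : a * d - b * c = 1.
Let h := mx2 a b c d.
Let h' := mx2 d (- b) (- c) a.

(** Cocycle relation of the denominators for the product [h h' = 1]. *)
Lemma mobius_den_inv (y : R) : mobius_den h' y != 0 ->
  mobius_den h (mobius h' y) = (mobius_den h' y)^-1.
Proof.
rewrite /mobius /mobius_den /mobius_num !mxE /= => D0.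
by apply: (mulIf D0); rewrite mulVf// mulrDl mulrA mulfVK// -det1; ring.
Qed.

Lemma mobius_inv (y : R) : mobius_den h' y != 0 ->
  mobius h (mobius h' y) = y.
Proof.
move=> D0; rewrite {1}/mobius mobius_den_inv// invrK.
move: D0; rewrite /mobius /mobius_den /mobius_num !mxE /= => D0.
by rewrite mulrDl -mulrA mulfVK// -[RHS]mul1r -det1; ring.
Qed.

Lemma is_derive_mobius (y : R) : mobius_den h' y != 0 ->
  is_derive y 1 (mobius h') ((mobius_den h' y)^-1 ^+ 2).
Proof.
rewrite /mobius /mobius_den /mobius_num !mxE /= => D0.
have dN : is_derive y 1 (fun y => d * y + - b) (0 * y + d * 1 + 0).
  exact: is_deriveD (is_deriveM1 (is_derive_cst d y 1) (is_derive_id y 1)) (is_derive_cst _ _ _).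
have dD : is_derive y 1 (fun y => - c * y + a) (0 * y + - c * 1 + 0).
  exact: is_deriveD (is_deriveM1 (is_derive_cst (- c) y 1) (is_derive_id y 1)) (is_derive_cst _ _ _).
have := is_deriveM1 dN (is_deriveV (f := fun y => - c * y + a) D0 dD) => hd.
apply: (is_derive_eq hd).
rewrite /GRing.scale /=.
transitivity ((a * d - b * c) * (- c * y + a)^-1 ^+ 2); last by rewrite det1 mul1r.
by field.
Qed.

End Pullback.

(* For a real test function F, the transformation law turns F times the
   automorphy factor |den|^(-1-lambda) into the real test function obtained by
   transporting F by H, so that real parts can be compared. *)
Lemma automorphic_transport (lambda : R[i]) (delta : 'Z_2)
    (Gamma : set 'M[int]_2) (tau : functional R * functional R)
    (H : 'M[int]_2) (F : R -> R) :
  normal_finite_index Gamma -> automorphic lambda delta Gamma tau -> Gamma H ->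
  (forall z, F z != 0 -> mobius_den (real_mx R H) z < 0) ->
  let k := mobius (invmx (real_mx R H)) in
  let D := mobius_den (invmx (real_mx R H)) in
  let chi z := cpow (- mobius_den (real_mx R H) z) (- (1 + lambda)) * (F z)%:C in
  let eta y := if D y != 0 then F (k y) else 0 in
  test_on [set z | mobius_den (real_mx R H) z != 0] chi ->
  test (fun y => (eta y)%:C) ->
  tau.1 chi = ((-1) ^+ delta)%:C * tau.1 (fun y => (eta y)%:C).
Proof.
move=> [GSL _ [_ GV] _ _] [[dist1 _ _] aut] GH Fneg k D chi eta tchi teta.
have det1 : H 0 0 * H 1 1 - H 0 1 * H 1 0 = 1.
  by rewrite -det_mx2 -mx2E; exact: GSL.
have det1R : (H 0 0)%:~R * (H 1 1)%:~R - (H 0 1)%:~R * (H 1 0)%:~R = 1 :> R.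
  by rewrite -!intrM -intrB det1.
have HE : real_mx R H =
    mx2 (H 0 0)%:~R (H 0 1)%:~R (H 1 0)%:~R (H 1 1)%:~R.
  by rewrite {1}(mx2E H) real_mx_mx2.
have VE : invmx (real_mx R H) =
    mx2 (H 1 1)%:~R (- (H 0 1)%:~R) (- (H 1 0)%:~R) (H 0 0)%:~R.
  by rewrite HE invmx_mx2.
have gE : invmx (real_mx R (invmx H)) = real_mx R H.
  rewrite {1}(mx2E H) invmx_mx2// real_mx_mx2 invmx_mx2; last first.
    by rewrite -[RHS]det1R !intrN; ring.
  by rewrite !intrN !opprK -HE.
(* The action is written through the inverse of the group element, so invariance under [H^-1]
   produces the denominator of [H]. *)
have [[law _] _] := aut _ (GV _ GH).
move: law; rewrite gE => /(_ _ tchi) ->.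
rewrite /slash /dmul /dpull -/k -/D.
rewrite -is_distribution_scale//; congr (tau.1 _); apply/funext => y.
have -> : (y \in [set y | D y != 0]) = (D y != 0).
  by apply/idP/idP; rewrite in_setE.
rewrite /eta; have [D0|D0] := eqVneq (D y) 0; first by rewrite /= mulr0.
rewrite /chi; have [->|Fk0] := eqVneq (F (k y)) 0; first by rewrite !mulr0.
have denE : mobius_den (real_mx R H) (k y) = (D y)^-1.
  by move: D0; rewrite /k /D VE HE => D0; exact: mobius_den_inv.
have D'0 : 0 < - (D y)^-1 by rewrite oppr_gt0 -denE; exact: Fneg.
have -> : derive1 k y = (D y)^-1 ^+ 2.
  apply: is_derive1_val; move: D0; rewrite /k /D VE => D0.
  exact: is_derive_mobius.
rewrite denE /sgpow -[X in Num.sg X]opprK sgrN gtr0_sg//.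
have -> : `|(D y)^-1| = - (D y)^-1 by rewrite -normrN gtr0_norm.
set u := - (D y)^-1 in D'0 *.
have -> : `|(D y)^-1 ^+ 2| = u ^+ 2 by rewrite /u sqrrN ger0_norm ?sqr_ge0.
set P := cpow u (lambda - 1); set Q := cpow u _; rewrite /=.
(* The exponents [lambda - 1] of the action and [-(1 + lambda)] of [chi] add up to -2, which the
   Jacobian [u^2] cancels. The negative sign of the denominator leaves the factor [(-1)^delta]. *)
suff PQ : (u ^+ 2)%:C * (P * Q) = 1.
  by rewrite -[RHS]mul1r -PQ; ring.
rewrite /P /Q -cpowD//.
have -> : lambda - 1 - (1 + lambda) = (- 2%:R)%:C by rewrite rmorphN rmorph_nat; ring.
rewrite cpow_real powRN powR_mulrn ?ltW// -rmorphM /= mulfV// gt_eqF//.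
by rewrite exprn_gt0.
Qed.

End Automorphy.

(** * The pairing estimate transported by an element of the group *)

Section RenormalizedPairing.
Context {R : realType}.

Lemma derive1_eq0_off (K : set R) (f : R -> R) (x : R) : closed K ->
  (forall y, ~ K y -> f y = 0) -> ~ K x -> derive1 f x = 0.
Proof.
move=> cK f0 nKx.
rewrite (@derive1_eq_on _ (~` K) f (fun=> 0)) ?derive1_cst//.
- exact: closed_openC.
- by move=> y /set_mem; exact: f0.
- exact: mem_set.
Qed.

Lemma re_cpow_scale (r f : R) (s : R[i]) :
  re (cpow r s * f%:C) = r `^ re s * cos (im s * ln r) * f.
Proof. by rewrite /cpow /cis /re /=; ring. Qed.

Lemma im_cpow_scale (r f : R) (s : R[i]) :
  im (cpow r s * f%:C) = r `^ re s * sin (im s * ln r) * f.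
Proof. by rewrite /cpow /cis /im /=; ring. Qed.

Lemma smooth_on_affine (U : set R) (a b : R) : open U ->
  smooth_on U (fun x => a * x + b).
Proof.
move=> oU; apply: smooth_onD (smooth_on_cst _ oU) => //.
by apply: smooth_onM (smooth_on_cst _ oU) (smooth_on_id oU).
Qed.

Lemma csmooth_cpow (U K : set R) (u F : R -> R) (s : R[i]) :
  open U -> closed K -> K `<=` U -> (forall z, U z -> 0 < u z) ->
  smooth_on U u -> smooth_on U F -> (forall z, ~ K z -> F z = 0) ->
  csmooth (fun z => cpow (u z) s * (F z)%:C).
Proof.
move=> oU cK KU u0 su sF F0.
have slnu : smooth_on U (fun z => ln (u z)).
  by apply: smooth_on_comp su => //; [exact: open_gt0|exact: u0|exact: smooth_on_ln].
have spow : smooth_on U (fun z => u z `^ re s).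
  apply: (@smooth_on_ext _ _ (fun z => expR (re s * ln (u z)))) => //.
    by move=> z /set_mem Uz; rewrite /powR gt_eqF// u0.
  apply: (@smooth_on_comp _ _ setT (@expR R)) => //; [exact: openT|exact: smooth_on_expR|].
  exact: smooth_onM (smooth_on_cst _ oU) slnu.
have sarg : smooth_on U (fun z => im s * ln (u z)).
  exact: smooth_onM (smooth_on_cst _ oU) slnu.
have scos : smooth_on setT (fun z => u z `^ re s * cos (im s * ln (u z)) * F z).
  apply: (smooth_on_extend0 oU cK KU) => [|z /F0 ->]; last by rewrite mulr0.
  do 2 (apply: smooth_onM => //).
  by apply: (@smooth_on_comp _ _ setT (@cos R)) => //; [exact: openT|exact: smooth_on_cos].
have ssin : smooth_on setT (fun z => u z `^ re s * sin (im s * ln (u z)) * F z).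
  apply: (smooth_on_extend0 oU cK KU) => [|z /F0 ->]; last by rewrite mulr0.
  do 2 (apply: smooth_onM => //).
  by apply: (@smooth_on_comp _ _ setT (@sin R)) => //; [exact: openT|exact: smooth_on_sin].
move=> n x; split.
  rewrite (_ : (fun t => re _) = fun z => u z `^ re s * cos (im s * ln (u z)) * F z).
    by case: scos => /(_ n x I).
  by apply/funext => z; exact: re_cpow_scale.
rewrite (_ : (fun t => im _) = fun z => u z `^ re s * sin (im s * ln (u z)) * F z).
  by case: ssin => /(_ n x I).
by apply/funext => z; exact: im_cpow_scale.
Qed.

(** Up to a sign, [chi] is paired like the real function [eta = F o H^-1], which lives in a ball of
    radius [M / q^2] around [x0]. Differentiating [H^-1] costs at most [(M q)^2], and
    [re_pairing_bound] concludes. *)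
Lemma renormalized_pairing_bound (lambda : R[i]) (delta : 'Z_2)
    (Gamma : set 'M[int]_2) (tau : functional R * functional R) (c0 : R[i])
    (phi : R -> R[i]) (x0 A0 A M q L B : R) (H : 'M[int]_2) (F : R -> R)
    (e := 2 * (M / q ^+ 2)) (h := real_mx R H)
    (chi := fun z => cpow (- mobius_den h z) (- (1 + lambda)) * (F z)%:C) :
  normal_finite_index Gamma -> automorphic lambda delta Gamma tau ->
  ccontinuous phi ->
  deq_on setT tau.1 (dist_add (dist_fun (fun=> c0)) (dderive (dist_fun phi))) ->
  A0 < A -> 0 < M -> 0 < q -> 0 <= B -> renormalizing Gamma x0 A M q H ->
  smooth_on [set z | `|z| < A] F -> (forall z, A0 < `|z| -> F z = 0) ->
  (forall z, `|z| < A -> `|F z| <= B) ->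
  (forall z, `|z| < A -> `|derive1 F z| <= B) ->
  (forall x, `|x - x0| <= e -> `|re (phi x) - re (phi x0)| <= L) ->
  test chi /\
  `|re (tau.1 chi)| <=
    `|re c0| * (B * (2 * e)) + L * (B * (M * q) ^+ 2) * (2 * e).
Proof.
move=> nG aut cphi Teq A0A M0 q0 B0 [GH _ Hden Hdist] sF F0 FB F'B phiL.
pose U := [set z : R | `|z| < A]; pose K := [set z : R | `|z| <= A0].
have oU : open U by exact: open_norm_lt.
have KE : K = `[- A0, A0]%classic.
  by apply/seteqP; split=> z; rewrite /K /= in_itv/= ler_norml.
have compK : compact K by rewrite KE; exact: segment_compact.
have cK : closed K by rewrite KE; exact: itv_closed.
have KU : K `<=` U by move=> z /= /le_lt_trans; apply.
have FK z : ~ K z -> F z = 0 by move=> /negP; rewrite -ltNge => /F0.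
have F_U z : F z != 0 -> U z.
  by move=> Fz; apply: KU; apply: contrapT => /FK/eqP; rewrite (negPf Fz).
have u0 z : U z -> 0 < - mobius_den h z.
  by move=> /Hden /andP[h1 _]; exact: lt_le_trans h1.
have sFT : smooth_on setT F := smooth_on_extend0 oU cK KU sF FK.
have su : smooth_on U (fun z => - mobius_den h z).
  apply: (smooth_on_ext oU _ (smooth_on_affine (- h 1 0) (- h 1 1) oU)) => z _.
  by rewrite /mobius_den; ring.
have tchiU : test_on [set z | mobius_den h z != 0] chi.
  split; first exact: csmooth_cpow oU cK KU u0 su sF FK.
  exists K; split=> // [z /KU /u0 /= |z /FK Fz]; last by rewrite /chi Fz mulr0.
  by rewrite oppr_gt0 => /lt_eqF ->.
have tchi : test chi.
  by case: tchiU => schi [K' [cK' K'U chi0]]; split=> //; exists K'; split.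
split=> //.
have [GSL _ [_ GV] _ _] := nG.
have det1 : h 0 0 * h 1 1 - h 0 1 * h 1 0 = 1.
  by rewrite -det_mx2 -mx2E /h /real_mx det_map_mx (GSL _ GH) rmorph1.
have VE : invmx h = mx2 (h 1 1) (- h 0 1) (- h 1 0) (h 0 0).
  by rewrite {1}(mx2E h) invmx_mx2.
pose k := mobius (invmx h); pose D := mobius_den (invmx h).
pose eta y := if D y != 0 then F (k y) else 0.
have DE y : D y = - h 1 0 * y + h 0 0 by rewrite /D VE /mobius_den !mxE.
have kE y : k y = (h 1 1 * y + - h 0 1) * (D y)^-1.
  by rewrite /k /mobius -/(D y) VE /mobius_num !mxE.
have sD V : open V -> smooth_on V D.
  move=> oV.
  apply: (smooth_on_ext oV _ (smooth_on_affine (- h 1 0) (h 0 0) oV)) => y _.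
  by rewrite DE.
have cD : continuous D := smooth_continuous (sD _ openT).
pose V := [set y | D y != 0].
have oV : open V by apply: open_comp (open_neq0) => y _; exact: cD.
have denk y : V y -> mobius_den h (k y) = (D y)^-1.
  by rewrite /V /= /k /D VE => D0; have := mobius_den_inv det1 D0; rewrite -mx2E.
have mobk y : V y -> mobius h (k y) = y.
  by rewrite /V /= /k /D VE => D0; have := mobius_inv det1 D0; rewrite -mx2E.
have dk y : V y -> is_derive y 1 k ((D y)^-1 ^+ 2).
  by rewrite /V /= /k /D VE => D0; exact: (is_derive_mobius det1 D0).
have sk : smooth_on V k.
  apply: (@smooth_on_ext _ _ (fun y => (h 1 1 * y + - h 0 1) * (D y)^-1) k oV).
    by move=> y _; rewrite kE.
  apply: smooth_onM => //; first exact: smooth_on_affine.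
  by apply: (smooth_on_comp oV open_neq0 _ smooth_on_inv) => //; exact: sD.
have etaE : {in V, (fun y => F (k y)) =1 eta}.
  by move=> y /set_mem Vy; rewrite /eta ifT.
have eta_neq0 y : eta y != 0 -> V y /\ U (k y).
  by rewrite /eta; case: ifPn => [Vy /F_U|]; rewrite ?eqxx.
have Dk y : V y -> U (k y) -> q <= - (D y)^-1 <= M * q.
  by move=> Vy Uk; rewrite -denk//; exact: Hden.
(* The upper bound on the denominator of [H] keeps the support of [eta] away from the pole of
   [H^-1], so that extension by zero is smooth. *)
pose K' := [set y | (M * q)^-1 <= - D y].
have Mq0 : 0 < M * q by rewrite mulr_gt0.
have cK' : closed K'.
  apply: (@closed_comp _ _ (fun y => - D y) [set t | (M * q)^-1 <= t]).
    by move=> y _; apply: cvgN; exact: cD.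
  exact: closed_ge.
have K'V : K' `<=` V.
  move=> y Ky; rewrite /V /= -oppr_eq0 gt_eqF// (lt_le_trans _ Ky)//.
  by rewrite invr_gt0.
have etaK' y : ~ K' y -> eta y = 0.
  move=> nKy; apply/eqP; apply: contrapT => /negP /eta_neq0[Vy Uk]; apply: nKy.
  have /andP[h1 h2] := Dk y Vy Uk; rewrite /K' /=.
  rewrite -[- D y]invrK invrN lef_pV2 ?posrE// (lt_le_trans q0)//.
have seta : smooth_on setT eta.
  apply: (smooth_on_extend0 oV cK' K'V _ etaK').
  apply: (smooth_on_ext oV etaE).
  by apply: (smooth_on_comp oV openT _ sFT).
have Mq20 : 0 < M / q ^+ 2 by rewrite divr_gt0 ?exprn_gt0.
have e0 : 0 < e by rewrite mulr_gt0.
(* Since [e] is twice the radius of the image, [eta] vanishes on the boundary [|y - x0| = e] as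
   well. *)
have eta0 y : e <= `|y - x0| -> eta y = 0.
  move=> ey; apply/eqP; apply: contrapT => /negP /eta_neq0[Vy Uk].
  have := Hdist _ Uk; rewrite -/h mobk// => /(le_trans ey).
  by rewrite leNgt /e => /negP; apply; rewrite ltr_pMl// ltr1n.
have teta : test (fun y => (eta y)%:C).
  apply: (@test_onP R setT `[x0 - e, x0 + e]) => //; first exact: segment_compact.
  by move=> x /= /negP; rewrite in_itv/= -ler_distl -ltNge => /ltW; exact: eta0.
have Fneg z : F z != 0 -> mobius_den h z < 0.
  by move=> /F_U /u0; rewrite oppr_gt0.
have -> : tau.1 chi = ((-1) ^+ delta)%:C * tau.1 (fun y => (eta y)%:C).
  exact: automorphic_transport nG aut GH Fneg tchiU teta.
have -> (s : R) (z : R[i]) : re (s%:C * z) = s * re z.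
  by case: z => a b; rewrite /re /= mul0r subr0.
rewrite normrM normrX normrN1 expr1n mul1r.
have BMq0 : 0 <= B * (M * q) ^+ 2 by apply: mulr_ge0 => //; exact: sqr_ge0.
apply: (re_pairing_bound cphi Teq e0 seta eta0 _ _ phiL).
- move=> y _; have [->|ny] := eqVneq (eta y) 0; first by rewrite normr0.
  by have [Vy Uk] := eta_neq0 _ ny; rewrite -etaE ?mem_set// FB.
- move=> y _.
  have [Vy|nVy] := pselect (V y); last first.
    rewrite (derive1_eq0_off cK' etaK') ?normr0//.
    by move=> /K'V.
  rewrite -(derive1_eq_on oV etaE) ?mem_set//.
  (* The inner derivative [(D y)^-2] is the squared denominator of [H] at [k y], bounded by
     [(M q)^2] where [k y] is in [U]; elsewhere the derivative of [F] is zero. *)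
  rewrite (is_derive1_val (is_derive1_comp (smooth_on_is_derive sFT I) (dk y Vy))).
  rewrite normrM; have [Uk|nUk] := pselect (U (k y)).
    apply: ler_pM => //; first exact: F'B.
    have /andP[h1 h2] := Dk y Vy Uk.
    rewrite normrX -normrN gtr0_norm ?(lt_le_trans q0)//.
    by rewrite ler_pXn2r// nnegrE ltW// (lt_le_trans q0).
  rewrite (derive1_eq0_off cK FK) ?normr0 ?mul0r//.
  by move=> /KU.
Qed.

End RenormalizedPairing.

(** * Upper limits, and elementary bounds for phases and powers *)

Section Families.
Context {R : realType}.

Lemma continuous_supp_bounded (f : R -> R) (A0 : R) : continuous f ->
  (forall z, A0 < `|z| -> f z = 0) -> exists2 B : R, 0 <= B & forall z, `|f z| <= B.
Proof.
move=> cf f0.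
have cK : compact (f @` `[- A0, A0]).
  by apply: continuous_compact; [exact: continuous_subspaceT|exact: segment_compact].
have [M [_ MP]] := compact_bounded cK.
exists (`|M| + 1); first by rewrite addr_ge0.
move=> z; have [zA|zA] := leP `|z| A0; last by rewrite f0// normr0 addr_ge0.
apply: MP; first by rewrite (le_lt_trans (ler_norm _))// ltrDl.
by exists z => //=; rewrite in_itv/= -ler_norml.
Qed.

(** Turns the negation of the theorem into a Hoelder bound near [x0]; the upper limit is over
    punctured neighbourhoods, which accounts for [x != x0]. *)
Lemma lime_sup_neq_pinfty (f : R -> R) (x0 : R) :
  lime_sup (fun x => (f x)%:E) x0 <> +oo%E ->
  exists (L r : R), 0 < r /\ forall x, x != x0 -> `|x - x0| < r -> f x <= L.
Proof.
move=> /eqP; rewrite -ltey /lime_sup /limf_esup => /ereal_inf_lt[_ [V Vx0 <-]].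
move=> supV; have [r r0 rV] := Vx0.
have [L supL] : exists L : R, (ereal_sup [set (f x)%:E | x in V] <= L%:E)%E.
  case: (ereal_sup _) supV => [L| |] _ //; first by exists L.
  (* A supremum equal to minus infinity is below any real number. *)
  by exists 0; rewrite leNye.
exists L, r; split=> // x xx0 xr; rewrite -lee_fin (le_trans _ supL)//.
apply: ereal_sup_ubound; exists x => //; apply: rV => //.
by rewrite /ball_ /= distrC.
Qed.

(** The sine increases up to [pi / 2], which is at least 1. *)
Lemma sin_lower_bound (nu l t : R) : 0 < `|nu| * l -> l <= t -> `|nu| * t <= 1 ->
  sin (`|nu| * l) <= `|sin (nu * t)|.
Proof.
move=> l0 lt t1.
have -> : `|sin (nu * t)| = `|sin (`|nu| * t)|.
  by have [//|_] := ger0P nu; rewrite mulNr sinN normrN.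
have lt' : `|nu| * l <= `|nu| * t by rewrite ler_wpM2l.
have p1 : (1 : R) <= pi / 2 by rewrite ler_pdivlMr// mul1r pi_ge2.
have h : sin (`|nu| * l) <= sin (`|nu| * t).
  move: (lt'); rewrite le_eqVlt => /predU1P[->//|h].
  by apply: ltW; rewrite ltr_sin ?in_itv//=; apply/andP; split; lra.
by apply: (le_trans h); exact: ler_norm.
Qed.

Lemma powR_exp_cancel (q w u s : R) : 0 < q -> 0 < w -> u = q * w ->
  q `^ s * (u `^ (- s) * expR (s * ln w)) = 1.
Proof.
move=> q0 w0 ->; rewrite powRM ?ltW// !powRN.
have -> : expR (s * ln w) = w `^ s by rewrite /powR gt_eqF.
by field; rewrite !powR_eq0 !(gt_eqF q0, gt_eqF w0).
Qed.

(* Splits a real function into two parts with prescribed phases and real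
   coefficients. *)
Lemma cis_split (a a' : R) : cis (- a) * (sin a')%:C - cis (- a') * (sin a)%:C
  = (sin (a' - a))%:C.
Proof.
apply/eqP; rewrite /cis !cosN !sinN eq_complex /= sinB.
by apply/andP; split; apply/eqP; ring.
Qed.

End Families.

(** * Real combinations of two automorphy factors *)

Section PhaseSplitting.
Context {R : realType}.

(** The real coefficient removes the modulus of the automorphy factor, so only its phase
    survives. *)
Lemma cpow_cancel (q w : R) (lambda : R[i]) (x : R) : 0 < q -> 0 < w ->
  cpow (q * w) (- (1 + lambda)) *
    (q `^ (1 + re lambda) * (expR ((1 + re lambda) * ln w) * x))%:C =
  cis (- (im lambda * ln (q * w))) * x%:C.
Proof.
move=> q0 w0; case: lambda => a b; rewrite /cpow /re /im /= add0r mulNr.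
have := powR_exp_cancel (1 + a) q0 w0 erefl.
set P := q `^ _; set Q := _ `^ - _; set E := expR _ => PQE.
transitivity (cis (- (b * ln (q * w))) * ((P * (Q * E)) * x)%:C).
  by rewrite !(rmorphM (real_complex R)); ring.
by rewrite PQE mul1r.
Qed.

(** The power [q Q ^ (1 + re lambda)] is split off the coefficients so that [G] and [G'] remain
    bounded, with their derivatives, uniformly in [Q]. *)
Record splitting (U : set R) (lambda : R[i]) (q : nat -> R)
    (w w' : nat -> R -> R) (chi : R -> R) (G G' : nat -> R -> R) : Prop := Splitting {
  splitting_tame : tame U G /\ tame U G';
  splitting_bounded : ubounded U G /\ ubounded U G';
  splitting_supp : forall Q z, chi z = 0 -> G Q z = 0 /\ G' Q z = 0;
  splitting_eq : forall Q z, U z -> (chi z)%:C =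
    cpow (q Q * w Q z) (- (1 + lambda)) * (q Q `^ (1 + re lambda) * G Q z)%:C +
    cpow (q Q * w' Q z) (- (1 + lambda)) * (q Q `^ (1 + re lambda) * G' Q z)%:C }.

(** For [im lambda != 0] one solves a real linear system whose determinant is the sine of the phase
    difference. This difference depends on the ratio [w' / w] only, not on [q], and the bounds on
    the logarithms keep the sine away from zero. *)
Lemma splitting_exists (U : set R) (lambda : R[i]) (q : nat -> R)
    (w w' : nat -> R -> R) (chi : R -> R) (l : R) :
  open U -> (forall Q, 0 < q Q) -> tame U w -> tame U w' ->
  (forall Q z, U z -> 1 <= w Q z) -> (forall Q z, U z -> 1 <= w' Q z) ->
  ubounded U w -> ubounded U w' ->
  smooth_on setT chi -> ubounded U (fun _ : nat => chi) ->
  ubounded U (fun _ : nat => derive1 chi) -> 0 < l ->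
  `|im lambda| * l <= 1 ->
  (forall Q z, U z -> l <= ln (w' Q z) - ln (w Q z)) ->
  (forall Q z, U z -> `|im lambda| * (ln (w' Q z) - ln (w Q z)) <= 1) ->
  exists G G', splitting U lambda q w w' chi G G'.
Proof.
move=> oU q0 tw tw' w1 w1' bw bw' schi bchi bchi' l0 nul1 lw lw1.
set rho := re lambda; set nu := im lambda in nul1 lw1 *.
have w0 Q z : U z -> 0 < w Q z by move=> /(w1 Q); exact: lt_le_trans.
have w0' Q z : U z -> 0 < w' Q z by move=> /(w1' Q); exact: lt_le_trans.
have tchi : tame U (fun _ : nat => chi).
  by split=> // _; exact: smooth_on_sub schi.
have tln := tame_ln oU w1 tw; have bln := ubounded_ln w1 bw.
have tln' := tame_ln oU w1' tw'; have bln' := ubounded_ln w1' bw'.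
have texp v : tame U v -> ubounded U v ->
    tame U (fun Q z => expR ((1 + rho) * v Q z)).
  by move=> tv bv; apply: tame_expR; [|exact: tameZ|exact: uboundedZ].
have bexp v : ubounded U v -> ubounded U (fun Q z => expR ((1 + rho) * v Q z)).
  by move=> bv; apply: ubounded_expR; exact: uboundedZ.
(* For real [lambda] the automorphy factor is real and the first matrix alone suffices. *)
have [nu0|nu0] := eqVneq nu 0.
  exists (fun Q z => expR ((1 + rho) * ln (w Q z)) * chi z), (fun _ _ => 0); split.
  - split; last exact: tame_cst.
    by apply: tameM => //; [exact: texp|exact: bexp].
  - by split; [apply: uboundedM => //; exact: bexp|exact: ubounded_cst].
  - by move=> Q z ->; rewrite mulr0.
  - move=> Q z Uz; rewrite cpow_cancel ?w0// -/nu nu0 mul0r oppr0 !mulr0 addr0.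
    by rewrite /cis cos0 sin0; apply/eqP; rewrite eq_complex /=;
      apply/andP; split; apply/eqP; ring.
pose S Q z := sin (nu * (ln (w' Q z) - ln (w Q z))).
have nul0 : 0 < `|nu| * l by rewrite mulr_gt0// normr_gt0.
have m0 : 0 < sin (`|nu| * l).
  by apply: sin_gt0_pi; rewrite nul0 (le_lt_trans nul1)// (lt_le_trans _ (pi_ge2 R))// ltr1n.
have mS Q z : U z -> sin (`|nu| * l) <= `|S Q z|.
  by move=> Uz; apply: sin_lower_bound => //; [exact: lw|exact: lw1].
have tS : tame U S.
  apply: tame_sin => //; apply: tameZ => //.
  have := tameD oU tln' (tameZ oU (-1) tln).
  by congr tame; apply/funext => Q; apply/funext => z; rewrite mulN1r.
have tiS := tame_inv oU m0 mS tS; have biS := ubounded_inv m0 mS.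
pose a Q z := nu * ln (q Q * w Q z); pose a' Q z := nu * ln (q Q * w' Q z).
(* The unbounded term [ln (q Q)] is constant in [z], so it does not affect the derivative. *)
have ta v : (forall Q z, U z -> 0 < v Q z) -> tame U (fun Q z => ln (v Q z)) ->
    tame U (fun Q z => sin (nu * ln (q Q * v Q z))).
  move=> v0 tv; apply: tame_sin => //; apply: tameZ => //.
  have := tameD oU (tame_cst oU (fun Q => ln (q Q))) tv.
  apply: tame_ext => // Q z Uz; rewrite lnM ?posrE//; exact: v0.
(* Cramer's rule, in the form of [cis_split]; the exponentials are the powers of [w] and [w'] that
   compensate the moduli. *)
exists (fun Q z => expR ((1 + rho) * ln (w Q z)) * (sin (a' Q z) * ((S Q z)^-1 * chi z))).
exists (fun Q z => expR ((1 + rho) * ln (w' Q z)) * (-1 * (sin (a Q z) * ((S Q z)^-1 * chi z)))).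
have tSchi : tame U (fun Q z => (S Q z)^-1 * chi z) by exact: tameM.
have bSchi : ubounded U (fun Q z => (S Q z)^-1 * chi z) by exact: uboundedM.
have tsS v : (forall Q z, U z -> 0 < v Q z) -> tame U (fun Q z => ln (v Q z)) ->
    tame U (fun Q z => sin (nu * ln (q Q * v Q z)) * ((S Q z)^-1 * chi z)).
  by move=> v0 tv; apply: tameM => //; [exact: ta|exact: ubounded_sin].
have bsS (v : nat -> R -> R) : ubounded U (fun Q z => sin (v Q z) * ((S Q z)^-1 * chi z)).
  by apply: uboundedM => //; exact: ubounded_sin.
split.
- split.
    by apply: tameM; [|exact: texp|exact: tsS|exact: bexp|exact: bsS].
  apply: tameM; [by []|exact: texp| |exact: bexp|exact: uboundedZ].
  by apply: tameZ => //; exact: tsS.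
- split; first by apply: uboundedM; [exact: bexp|exact: bsS].
  by apply: uboundedM; [exact: bexp|exact: uboundedZ].
- by move=> Q z ->; rewrite !mulr0.
- move=> Q z Uz; rewrite !cpow_cancel ?w0 ?w0'//.
  have S0 : S Q z != 0 by rewrite -normr_gt0 (lt_le_trans m0)// mS.
  have SE : S Q z = sin (a' Q z - a Q z).
    by rewrite /S /a /a' -mulrBr !lnM ?posrE ?w0 ?w0'//; congr sin; ring.
  rewrite -/(a Q z) -/(a' Q z) -[chi z in LHS](mulVKf S0).
  transitivity ((cis (- a Q z) * (sin (a' Q z))%:C - cis (- a' Q z) * (sin (a Q z))%:C)
      * ((S Q z)^-1 * chi z)%:C).
    by rewrite cis_split -SE (rmorphM (real_complex R)).
  by rewrite !(rmorphM (real_complex R)) rmorphN1; ring.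
Qed.

End PhaseSplitting.

(** * A Hoelder bound forces the real part to vanish on real test functions *)

Section Vanishing.
Context {R : realType}.

Lemma eq0_of_powR_decay (v C s1 s2 : R) : 0 <= C -> 0 < s1 -> 0 < s2 ->
  (forall Q : nat, exists2 q : R, Q%:R < q & `|v| <= C * (q `^ (- s1) + q `^ (- s2))) ->
  v = 0.
Proof.
move=> C0 s10 s20 vC; apply/eqP; rewrite -normr_eq0; apply/negPn/negP => v0.
have {}v0 : 0 < `|v| by rewrite lt_neqAle eq_sym v0/=.
pose s := Num.min s1 s2.
have s0 : 0 < s by rewrite lt_min s10.
(* Beyond [X] one has [|v| q^s > 2 (C + 1)], whereas the hypothesis gives [|v| q^s <= 2 C] for
   [q >= 1]. *)
pose X := (2 * (C + 1) / `|v|) `^ s^-1.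
have X0 : 0 <= X by exact: powR_ge0.
have [q qQ vq] := vC (Num.bound X).+1.
have Xq : X < q.
  by rewrite (lt_trans _ qQ)// (lt_trans (archi_boundP X0))// ltr_nat.
have q1 : 1 <= q by rewrite ltW// (le_lt_trans _ qQ)// ler1n.
have q0 : 0 < q := lt_le_trans ltr01 q1.
have qs : q `^ (- s1) + q `^ (- s2) <= 2 * q `^ (- s).
  rewrite mulr_natl mulr2n; apply: lerD; apply: ler_powR => //;
    by rewrite lerN2 ge_min lexx ?orbT.
have Xs : 2 * (C + 1) / `|v| < q `^ s.
  have -> : 2 * (C + 1) / `|v| = X `^ s.
    rewrite /X -powRrM mulVf ?gt_eqF// powRr1//.
    by rewrite divr_ge0// mulr_ge0// addr_ge0.
  by apply: gt0_ltr_powR => //; rewrite nnegrE// ltW.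
have qs0 : 0 < q `^ s by exact: powR_gt0.
move: Xs; rewrite ltr_pdivrMr// => Xs.
have : `|v| * q `^ s <= 2 * C.
  have : C * (q `^ (- s1) + q `^ (- s2)) <= C * (2 * q `^ (- s)) by rewrite ler_wpM2l.
  move=> /(le_trans vq); rewrite powRN => /(ler_wpM2r (ltW qs0)).
  by rewrite -!mulrA mulVf ?gt_eqF// mulr1 mulrC [C * 2]mulrC mulrC.
by move: Xs; rewrite [X in _ < X]mulrC => Xs h; have := lt_le_trans Xs h; lra.
Qed.

(** The pairing with [chi] is bounded by a constant times [q^(re lambda - 1) + q^(1 + re lambda - 2
    alpha)] for arbitrarily large [q]. The first power decays because [re lambda < 1], the second
    because [alpha > (1 + re lambda) / 2]. *)
Lemma re_vanishing (lambda : R[i]) (delta : 'Z_2) (Gamma : set 'M[int]_2)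
    (N : nat) (tau : functional R * functional R) (c0 : R[i]) (phi : R -> R[i])
    (x0 alpha L r : R) (chi : R -> R) (K : set R) :
  normal_finite_index Gamma -> cusp_width Gamma N ->
  automorphic lambda delta Gamma tau -> ccontinuous phi ->
  deq_on setT tau.1 (dist_add (dist_fun (fun=> c0)) (dderive (dist_fun phi))) ->
  irrational x0 -> re lambda < 1 -> 0 < alpha -> (1 + re lambda) / 2 < alpha ->
  0 < r ->
  (forall x, x != x0 -> `|x - x0| < r ->
    `|x - x0| `^ (- alpha) * `|re (phi x) - re (phi x0)| <= L) ->
  smooth_on setT chi -> compact K -> (forall z, ~ K z -> chi z = 0) ->
  re (tau.1 (fun z => (chi z)%:C)) = 0.
Proof.
move=> nG hN aut cphi Teq ix rho1 alpha0 halpha r0 holder schi cK chiK.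
set rho := re lambda in rho1 halpha.
have [A0 chi0] : exists A0 : R, forall z, A0 < `|z| -> chi z = 0.
  have [M [_ MP]] := compact_bounded cK.
  exists (`|M| + 1) => z zM; apply: chiK => /(MP (`|M| + 1)) /=.
  rewrite (le_lt_trans (ler_norm _)) ?ltrDl// => /(_ isT).
  by rewrite leNgt zM.
pose A := A0 + 1; pose U := [set z : R | `|z| < A].
have A0A : A0 < A by rewrite ltrDl.
have oU : open U by exact: open_norm_lt.
have bchi : ubounded U (fun _ : nat => chi).
  by have [B _ chiB] := continuous_supp_bounded (smooth_continuous schi) chi0; exists B.
have bchi' : ubounded U (fun _ : nat => derive1 chi).
  have chi'0 z : A0 < `|z| -> derive1 chi z = 0.
    move=> zA; apply: (@derive1_eq0_off _ `[- A0, A0]) => [|y|].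
    - exact: itv_closed.
    - by rewrite /= in_itv/= -ler_norml => /negP; rewrite -ltNge => /chi0.
    - by rewrite /= in_itv/= -ler_norml => /(lt_le_trans zA); rewrite ltxx.
  have [B _ chiB] := continuous_supp_bounded
    (smooth_continuous (smooth_on_derive1 schi)) chi'0.
  by exists B.
set nu := im lambda.
(* Then [n - 2 > |nu|], and since [ln (1 + 1 / (n - 2)) <= 1 / (n - 2)] the two phases differ by at
   most one radian. *)
pose n := (Num.bound `|nu|).+3.
have nR : n.-2%:R = (Num.bound `|nu|)%:R + 1 :> R by rewrite natr1.
have nun : `|nu| < (Num.bound `|nu|)%:R := archi_boundP (normr_ge0 nu).
have n20 : 0 < n.-2%:R :> R by rewrite ltr0n.
have [M M0 HM] := @renormalizing_matrices R Gamma N x0 A n nG hN ix isT.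
(* The shift to [Q + 1] ensures [q > 1] for every index. *)
have /choice[f fP] : forall Q : nat, exists HHq : 'M[int]_2 * 'M[int]_2 * R,
  [/\ (Q + 1)%:R < HHq.2, renormalizing Gamma x0 A M HHq.2 HHq.1.1,
      renormalizing Gamma x0 A M HHq.2 HHq.1.2 &
      forall z (u := - mobius_den (real_mx R HHq.1.1) z)
          (u' := - mobius_den (real_mx R HHq.1.2) z), `|z| < A ->
        (1 + n.+1%:R^-1) * u <= u' <= (1 + (n.-2)%:R^-1) * u].
  by move=> Q; have [H [H' [q HP]]] := HM (Q + 1)%N; exists (H, H', q).
pose q Q := (f Q).2; pose H Q := (f Q).1.1; pose H' Q := (f Q).1.2.
have q1 Q : 1 < q Q.
  by have [h _ _ _] := fP Q; rewrite (le_lt_trans _ h)// ler1n addn1.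
have q0 Q : 0 < q Q := lt_trans ltr01 (q1 Q).
(* Dividing by [q] brings the denominators into [[1, M]], uniformly in [Q]. *)
pose wd (H : nat -> 'M[int]_2) Q z := - mobius_den (real_mx R (H Q)) z / q Q.
have wdE H1 Q z : q Q * wd H1 Q z = - mobius_den (real_mx R (H1 Q)) z.
  by rewrite /wd mulrC divfK// gt_eqF.
have wdP H1 : (forall Q, renormalizing Gamma x0 A M (q Q) (H1 Q)) ->
    [/\ tame U (wd H1), (forall Q z, U z -> 1 <= wd H1 Q z) & ubounded U (wd H1)].
  move=> ren; have wd1 Q z : U z -> 1 <= wd H1 Q z <= M.
    by move=> /(renormalizing_den (ren Q)); rewrite /wd ler_pdivlMr// ler_pdivrMr// mul1r.
  split=> [|Q z /(wd1 Q)/andP[]//|]; last first.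
    exists M => Q z /(wd1 Q)/andP[w1 wM].
    by rewrite ger0_norm// (le_trans ler01).
  have t := @tame_affine R nat U oU (fun Q => - real_mx R (H1 Q) 1 0 / q Q)
                         (fun Q => - real_mx R (H1 Q) 1 1 / q Q).
  apply: (tame_ext oU _ (t _)) => [Q z _|].
    by rewrite /wd /mobius_den; ring.
  exists M => Q; rewrite normrM normrN normfV (gtr0_norm (q0 Q)) ler_pdivrMr//.
  exact: renormalizing_slope (ren Q).
have renH Q : renormalizing Gamma x0 A M (q Q) (H Q) by have [] := fP Q.
have renH' Q : renormalizing Gamma x0 A M (q Q) (H' Q) by have [] := fP Q.
have [tw w1 bw] := wdP H renH; have [tw' w1' bw'] := wdP H' renH'.
have w0 Q z : U z -> 0 < wd H Q z by move=> /(w1 Q); exact: lt_le_trans.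
have w0' Q z : U z -> 0 < wd H' Q z by move=> /(w1' Q); exact: lt_le_trans.
have ratio Q z : U z -> 1 + n.+1%:R^-1 <= wd H' Q z / wd H Q z <= 1 + n.-2%:R^-1.
  move=> Uz; have [_ _ _ /(_ z Uz)] := fP Q.
  rewrite -/(H Q) -/(H' Q) -!wdE ler_pdivlMr ?w0// ler_pdivrMr ?w0//.
  by rewrite !(mulrCA _ (q Q)) !(ler_pM2l (q0 Q)).
have lnB Q z : U z -> ln (wd H' Q z) - ln (wd H Q z) = ln (wd H' Q z / wd H Q z).
  move=> Uz; rewrite [RHS]ln_div ?posrE; [by []|exact: w0'|exact: w0].
pose l : R := ln (1 + n.+1%:R^-1).
have nV0 k : 0 < k.+1%:R^-1 :> R by rewrite invr_gt0 ltr0n.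
have l0 : 0 < l by rewrite ln_gt0// ltrDl.
have lnV k : ln (1 + k.+1%:R^-1) <= k.+1%:R^-1 :> R.
  by apply: le_ln1Dx; rewrite (lt_trans _ (nV0 k))// ltrN10.
have nun2 : `|nu| * n.-2%:R^-1 <= 1.
  by rewrite ler_pdivrMr// mul1r nR ltW// (lt_trans nun)// ltrDl.
have nul1 : `|nu| * l <= 1.
  apply: le_trans nun2; rewrite ler_wpM2l//; apply: (le_trans (lnV _)).
  by rewrite lef_pV2 ?posrE// ler_nat /n; lia.
have [G [G' [[tG tG'] [bG bG'] Gsupp Geq]]] : exists G G',
    splitting U lambda q (wd H) (wd H') chi G G'.
  apply: (@splitting_exists _ _ _ _ _ _ _ l) => //.
  - move=> Q z Uz; have /andP[h1 _] := ratio Q z Uz; rewrite lnB//.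
    have p1 : 0 < 1 + n.+1%:R^-1 :> R by exact: addr_gt0.
    by rewrite /l ler_ln ?posrE//; exact: lt_le_trans h1.
  - move=> Q z Uz; rewrite lnB//; apply: le_trans nun2; rewrite ler_wpM2l//.
    have /andP[h1 h2] := ratio Q z Uz.
    have p1 : 0 < 1 + n.+1%:R^-1 :> R by exact: addr_gt0.
    have p2 := lt_le_trans p1 h1; have p3 := lt_le_trans p2 h2.
    by apply: le_trans (lnV (Num.bound `|nu|)); rewrite ler_ln ?posrE.
have [B B0 [GB G'B]] : exists2 B : R, 0 <= B &
    (forall Q z, U z -> `|G Q z| <= B /\ `|derive1 (G Q) z| <= B) /\
    (forall Q z, U z -> `|G' Q z| <= B /\ `|derive1 (G' Q) z| <= B).
  have [B1 B10 h1] := ubounded_ge0 bG; have [B2 B20 h2] := ubounded_ge0 (tame_derive tG).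
  have [B3 B30 h3] := ubounded_ge0 bG'; have [B4 B40 h4] := ubounded_ge0 (tame_derive tG').
  exists (B1 + B2 + B3 + B4); first by rewrite !addr_ge0.
  by split=> Q z Uz; split;
    have := h1 Q z Uz; have := h2 Q z Uz; have := h3 Q z Uz; have := h4 Q z Uz; lra.
have [[dist1 _ _] _] := aut.
pose L' := Num.max 0 L.
have L'0 : 0 <= L' by rewrite le_max lexx.
pose C := 2 * (`|re c0| * (B * (4 * M)) + L' * (2 * M) `^ alpha * (B * M ^+ 2) * (4 * M)).
have C0 : 0 <= C.
  have M0' := ltW M0.
  by rewrite /C mulr_ge0// addr_ge0// !mulr_ge0// powR_ge0.
apply: (@eq0_of_powR_decay _ C (1 - rho) (2 * alpha - (1 + rho))) => //.
- by rewrite subr_gt0.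
- lra.
(* The second summand gives [q > 2M / r]; with [q > 1] this yields [e = 2M / q^2 < r], so the ball
   lies where the Hoelder bound holds. *)
move=> Q0; pose Q := (Q0 + Num.bound (2 * M / r))%N; exists (q Q).
  have [h _ _ _] := fP Q; rewrite (le_lt_trans _ h)// ler_nat /Q.
  by rewrite -addnA leq_addr.
pose e := 2 * (M / q Q ^+ 2).
have e0 : 0 < e by rewrite mulr_gt0// divr_gt0// exprn_gt0.
have er : e < r.
  have h : 2 * M / r < q Q.
    have Mr0 : 0 <= 2 * M / r by rewrite divr_ge0 ?mulr_ge0// ltW.
    have [h _ _ _] := fP Q; rewrite (lt_trans _ h)//.
    by rewrite (lt_le_trans (archi_boundP Mr0))// ler_nat /Q -addnA addnCA leq_addr.
  rewrite /e mulrA ltr_pdivrMr ?exprn_gt0//; move: h; rewrite ltr_pdivrMr// => h.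
  apply: (lt_le_trans h); rewrite mulrC ler_wpM2l ?ltW//.
  by rewrite expr2 ltr_pMr.
have phiL x : `|x - x0| <= e -> `|re (phi x) - re (phi x0)| <= L' * e `^ alpha.
  move=> xe; have [->|xx0] := eqVneq x x0.
    by rewrite subrr normr0 mulr_ge0// powR_ge0.
  have d0 : 0 < `|x - x0| by rewrite normr_gt0 subr_eq0.
  have := holder x xx0 (le_lt_trans xe er).
  rewrite powRN mulrC ler_pdivrMr ?powR_gt0// => /le_trans; apply.
  apply: (@le_trans _ _ (L' * `|x - x0| `^ alpha)).
    by rewrite ler_wpM2r ?powR_ge0// /L' le_max lexx orbT.
  by rewrite ler_wpM2l// ge0_ler_powR ?nnegrE// ltW.
pose P := q Q `^ (1 + rho).
have P0 : 0 <= P by exact: powR_ge0.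
have pairing (H1 : nat -> 'M[int]_2) (F : nat -> R -> R) : tame U F ->
    (forall Q z, U z -> `|F Q z| <= B /\ `|derive1 (F Q) z| <= B) ->
    (forall Q z, chi z = 0 -> F Q z = 0) ->
    renormalizing Gamma x0 A M (q Q) (H1 Q) ->
    let chi1 z := cpow (- mobius_den (real_mx R (H1 Q)) z) (- (1 + lambda)) *
       (P * F Q z)%:C in
    test chi1 /\ `|re (tau.1 chi1)| <= `|re c0| * (P * B * (2 * e)) +
       (L' * e `^ alpha) * (P * B * (M * q Q) ^+ 2) * (2 * e).
  move=> tF FB Fchi ren.
  apply: (renormalized_pairing_bound nG aut cphi Teq A0A M0 (q0 Q) _ ren) => //.
  - exact: mulr_ge0.
  - by apply: smooth_onM => //; [exact: smooth_on_cst|case: tF].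
  - by move=> z /chi0 /Fchi ->; rewrite mulr0.
  - by move=> z Uz; rewrite normrM ger0_norm// ler_wpM2l//; have [] := FB Q z Uz.
  - move=> z Uz.
    have d := is_deriveM1 (is_derive_cst P z 1) (tame_is_derive Q tF Uz).
    rewrite (is_derive1_val d) mul0r add0r normrM ger0_norm// ler_wpM2l//.
    by have [] := FB Q z Uz.
have [t1 b1] := pairing H G tG GB (fun Q z h => (Gsupp Q z h).1) (renH Q).
have [t2 b2] := pairing H' G' tG' G'B (fun Q z h => (Gsupp Q z h).2) (renH' Q).
have -> : (fun z => (chi z)%:C) = (fun z =>
    1 * (cpow (- mobius_den (real_mx R (H Q)) z) (- (1 + lambda)) * (P * G Q z)%:C) +
    cpow (- mobius_den (real_mx R (H' Q)) z) (- (1 + lambda)) * (P * G' Q z)%:C).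
  apply/funext => z; rewrite mul1r; have [Uz|nUz] := pselect (U z).
    by rewrite -!wdE; exact: Geq.
  have z0 : chi z = 0.
    by apply: chi0; rewrite (lt_le_trans A0A)// leNgt; exact/negP.
  by have [-> ->] := Gsupp Q z z0; rewrite z0 !mulr0 addr0.
rewrite (distribution_linear dist1 1 t1 t2) mul1r.
have -> (x y : R[i]) : re (x + y) = re x + re y by case: x y => [? ?] [? ?].
apply: (le_trans (ler_normD _ _)); apply: (le_trans (lerD b1 b2)).
(* Counting powers of [q]: the first term is of order [P e], with [P = q^(1 + rho)] and [e] of order
   [q^-2]. In the second, [q^2 e] is constant, which leaves [P e^alpha]. *)
have qn0 : q Q != 0 by rewrite gt_eqF.
have Pq2 : P * (q Q ^+ 2)^-1 = q Q `^ (- (1 - rho)).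
  rewrite /P -powR_mulrn ?ltW// -powRN -powRD ?qn0 ?implybT//.
  by congr (_ `^ _); lra.
have Peq : P * q Q `^ (- (2 * alpha)) = q Q `^ (- (2 * alpha - (1 + rho))).
  rewrite /P -powRD ?qn0 ?implybT//; congr (_ `^ _); lra.
have eE : e `^ alpha = (2 * M) `^ alpha * q Q `^ (- (2 * alpha)).
  rewrite /e mulrA powRM ?invr_ge0 ?exprn_ge0// ?mulr_ge0 ?(ltW M0) ?(ltW (q0 Q))//.
  congr (_ * _); rewrite powRN powRrM -powR_mulrn ?(ltW (q0 Q))//.
  by rewrite -powR_inv1 ?powR_ge0// -powRrM mulN1r powRN.
set a := q Q `^ (- (1 - rho)) in Pq2 *.
set b := q Q `^ (- (2 * alpha - (1 + rho))) in Peq *.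
have a0 : 0 <= a by exact: powR_ge0.
have b0 : 0 <= b by exact: powR_ge0.
set X := `|re c0| * (B * (4 * M)) in C C0 *.
set Y := L' * _ * _ * _ in C C0 *.
have M0' := ltW M0.
have X0 : 0 <= X by rewrite /X !mulr_ge0.
have Y0 : 0 <= Y.
  by rewrite /Y !mulr_ge0// powR_ge0.
have -> : `|re c0| * (P * B * (2 * e)) + L' * e `^ alpha * (P * B * (M * q Q) ^+ 2) * (2 * e) =
    X * a + Y * b.
  rewrite eE -Pq2 -Peq /X /Y /e; field; exact: qn0.
have Xb : 0 <= X * b by exact: mulr_ge0.
have Ya : 0 <= Y * a by exact: mulr_ge0.
by rewrite /C; lra.
Qed.

End Vanishing.

(** * Reduction to real test functions *)

Section RealPart.
Context {R : realType}.

Lemma csmooth_re (f : R -> R[i]) : csmooth f -> smooth_on setT (fun x => re (f x)).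
Proof. by move=> sf; constructor=> n x _; have [] := sf n x. Qed.

Lemma csmooth_im (f : R -> R[i]) : csmooth f -> smooth_on setT (fun x => im (f x)).
Proof. by move=> sf; constructor=> n x _; have [] := sf n x. Qed.

(** Writing [f = u + i v] with [u], [v] real, linearity gives [dre T f = re (T u) + i re (T v)]. *)
Lemma dre_eq0 (T : functional R) : is_distribution T ->
  (forall (chi : R -> R) (K : set R), smooth_on setT chi -> compact K ->
     (forall z, ~ K z -> chi z = 0) -> re (T (fun z => (chi z)%:C)) = 0) ->
  deq_on setT (dre T) (fun=> 0).
Proof.
move=> dT T0 f [sf [K [cK _ f0]]].
have sre := csmooth_re sf; have sim := csmooth_im sf.
have re0 x : ~ K x -> re (f x) = 0 by move=> /f0 ->.
have im0 x : ~ K x -> im (f x) = 0 by move=> /f0 ->.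
have tre : test (fun x => (re (f x))%:C) by exact: test_onP cK _ sre re0.
have tim : test (fun x => (im (f x))%:C) by exact: test_onP cK _ sim im0.
have lin a := distribution_linear dT a tim tre.
have fE : f = fun x => 'i * (im (f x))%:C + (re (f x))%:C.
  apply/funext => x; case: (f x) => a b; apply/eqP.
  by rewrite eq_complex /re /im /=; apply/andP; split; apply/eqP; ring.
have fbarE : (fun x => (f x)^*) = fun x => (- 'i) * (im (f x))%:C + (re (f x))%:C.
  apply/funext => x; case: (f x) => a b; apply/eqP.
  by rewrite eq_complex /re /im /=; apply/andP; split; apply/eqP; ring.
rewrite /dre fbarE lin {1}fE lin.
have := T0 _ _ sre cK re0; have := T0 _ _ sim cK im0.
case: (T _) => a b; case: (T _) => c d; rewrite /re /= => -> ->.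
set z := _ + _; suff -> : z = 0 by rewrite mul0r.
rewrite /z; apply/eqP; rewrite eq_complex /=; apply/andP; split; apply/eqP; ring.
Qed.

End RealPart.

Theorem theorem5p26 (R : realType)
  (Gamma : set 'M[int]_2) (N : nat)
  (lambda : R[i]) (delta : 'Z_2)
  (tau : functional R * functional R)
  (c : int -> R[i]) (phi : R -> R[i]) (x0 alpha : R)
  (hGamma : normal_finite_index Gamma)
  (hN : cusp_width Gamma N)
  (hlambda : re lambda = 0 \/
             (delta = 0 /\ ((-1 < lambda < 0) \/ (0 < lambda < 1))))
  (htau : automorphic lambda delta Gamma tau)
  (hext : natural_extension lambda delta N tau)
  (hc : fourier_series N tau.1 c)
  (hphi : normalized_antiderivative N tau.1 (c 0) phi)
  (hx0 : irrational x0)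
  (hre : ~ deq_on setT (dre tau.1) (fun=> 0))
  (hcase : [\/ re lambda <= 0 /\ 1 + re lambda <= alpha,
               [/\ re lambda <= 0, (1 + re lambda) / 2 < alpha
                 & irrationality_measure2 x0]
             | 0 < lambda /\ (1 + re lambda) / 2 < alpha]) :
  lime_sup (fun x => (`|x - x0| `^ (- alpha) *
                      `|re (phi x) - re (phi x0)|)%:E) x0 = +oo%E.
Proof.
(* The order on [R[i]] compares real parts and requires equal imaginary parts. *)
have [rho0 rho1] : -1 < re lambda /\ re lambda < 1.
  case: hlambda => [->|[_ [/andP[]|/andP[]]]]; first by split; lra.
    by rewrite !ltcE /= => /andP[_ h1] /andP[_ h2]; rewrite /re; lra.
  by rewrite !ltcE /= => /andP[_ h1] /andP[_ h2]; rewrite /re; lra.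
(* The three cases merge here; in case a) the inequality is strict because [1 + re lambda > 0]. *)
have halpha : (1 + re lambda) / 2 < alpha.
  by case: hcase => [[_ h]|[]//|[]//]; lra.
have alpha0 : 0 < alpha by lra.
have [cphi _ Teq _] := hphi; have [[dist1 _ _] _] := htau.
apply: contrapT => /lime_sup_neq_pinfty[L [r [r0 holder]]].
apply: hre; apply: dre_eq0 => // chi K schi cK chiK.
exact: re_vanishing hGamma hN htau cphi Teq hx0 rho1 alpha0 halpha r0 holder schi cK chiK.
Qed.
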